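(* Let $I\subset K[x_1,\ldots,x_n]$ be a graded prime ideal with $\dim I>0$. Then there exists a non-empty Zariski-open set $U\subset\mathrm{GL}_n(K)$ such that $T(g(I))$ is the same fan for all $g\in U$.
   Context: $K$ is an algebraically closed field of characteristic $0$ with trivial valuation; $\dim I$ denotes the Krull dimension of $K[x_1,\ldots,x_n]/I$. Each $g=(g_{ij})\in\mathrm{GL}_n(K)$ acts on $K[x_1,\ldots,x_n]$ by the automorphism $x_i\mapsto\sum_j g_{ij}x_j$; $\mathrm{GL}_n(K)$ has the Zariski topology. For $f=\sum_\nu a_\nu x^\nu$ and $\omega\in\mathbb{R}^n$, $\mathrm{in}_\omega(f)$ is the sum of the terms with $\omega\cdot\nu$ minimal, and $\mathrm{in}_\omega(I)$ is generated by all $\mathrm{in}_\omega(f)$, $f\in I$. The Gröbner fan $\mathrm{GF}(I)$ has as relatively open cones the classes of $\omega\sim\omega'\iff\mathrm{in}_\omega(I)=\mathrm{in}_{\omega'}(I)$. The tropical variety $T(I)=\{\omega:\mathrm{in}_\omega(f)\text{ is not a monomial for all }f\in I\}$ carries the fan structure of the subfan of $\mathrm{GF}(I)$ consisting of cones whose initial ideal contains no monomial. *)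

(* Defs.v *)
From HB Require Import structures.
From mathcomp Require Import all_boot all_order all_algebra.
From mathcomp Require Import mpoly.
From Stdlib Require Import Reals.
Set Implicit Arguments. Unset Strict Implicit. Unset Printing Implicit Defensive.
Import GRing.Theory.
Local Open Scope ring_scope.

Section Defs.
Variables (K : fieldType) (n : nat).
Notation P := {mpoly K[n]}.

Definition is_ideal (I : P -> Prop) : Prop :=
  [/\ I 0, (forall f g, I f -> I g -> I (f + g)) & (forall a f, I f -> I (a * f))].

Definition is_prime_ideal (I : P -> Prop) : Prop :=
  [/\ is_ideal I, ~ I 1 & (forall a b, I (a * b) -> I a \/ I b)].

Definition hcomp (d : nat) (f : P) : P :=
  \sum_(m <- msupp f | mdeg m == d) f@_m *: 'X_[m].

Definition is_graded_ideal (I : P -> Prop) : Prop :=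
  is_ideal I /\ (forall f d, I f -> I (hcomp d f)).

Definition subset_strict (A B : P -> Prop) : Prop :=
  (forall f, A f -> B f) /\ exists f, B f /\ ~ A f.

Definition krull_dim_ge (I : P -> Prop) (d : nat) : Prop :=
  exists Q : nat -> P -> Prop,
    (forall i : nat, leq i d -> is_prime_ideal (Q i)) /\
    (forall f, I f -> Q 0%N f) /\
    (forall i : nat, leq i.+1 d -> subset_strict (Q i) (Q i.+1)).

Definition krull_dim_pos (I : P -> Prop) : Prop := krull_dim_ge I 1.

Definition gact (g : 'M[K]_n) (f : P) : P :=
  f \mPo [tuple \sum_(j < n) g i j *: 'X_j | i < n].

Definition ideal_act (g : 'M[K]_n) (I : P -> Prop) : P -> Prop :=
  fun p => exists f, I f /\ p = gact g f.

Definition wdeg (w : 'I_n -> R) (m : 'X_{1..n}) : R :=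
  \big[Rplus/0%R]_(i < n) (w i * INR (m i))%R.

Definition Rleb (a b : R) : bool := if Rle_dec a b then true else false.

Definition init_form (w : 'I_n -> R) (f : P) : P :=
  \sum_(m <- msupp f | all (fun m' => Rleb (wdeg w m) (wdeg w m')) (msupp f))
     f@_m *: 'X_[m].

Definition gen_ideal (S : P -> Prop) : P -> Prop :=
  fun p => exists k (a s : 'I_k -> P),
    (forall i, S (s i)) /\ p = \sum_(i < k) a i * s i.

Definition init_ideal (w : 'I_n -> R) (I : P -> Prop) : P -> Prop :=
  gen_ideal (fun p => exists f, I f /\ p = init_form w f).

Definition is_monomial (p : P) : Prop :=
  exists (c : K) (m : 'X_{1..n}), c != 0 /\ p = c *: 'X_[m].

(* relatively open cone of the Groebner fan containing w *)
Definition gcone (I : P -> Prop) (w : 'I_n -> R) : ('I_n -> R) -> Prop :=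
  fun w' => forall p, init_ideal w I p <-> init_ideal w' I p.

Definition trop (I : P -> Prop) (w : 'I_n -> R) : Prop :=
  forall f, I f -> ~ is_monomial (init_form w f).

Definition trop_fan (I : P -> Prop) : (('I_n -> R) -> Prop) -> Prop :=
  fun C => exists w, (forall p, init_ideal w I p -> ~ is_monomial p) /\ C = gcone I w.

Definition mx_entries (g : 'M[K]_n) : 'I_(n * n) -> K := fun k => mxvec g 0 k.

Definition zariski_open_GL (U : 'M[K]_n -> Prop) : Prop :=
  exists S : {mpoly K[n * n]} -> Prop,
    forall g, U g <-> (g \in unitmx /\ exists q, S q /\ q.@[mx_entries g] != 0).

End Defs.

(* Main.v *)
Require Import Defs.
From HB Require Import structures.
From mathcomp Require Import all_boot all_order all_algebra.
From mathcomp Require Import perm.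
From mathcomp Require Import mpoly.
From Stdlib Require Import Reals Lra Classical FunctionalExtensionality PropExtensionality.
From mathcomp Require Import zify.

(* Both the Groebner fan of g(I) and the set of weights whose initial ideal is
   monomial-free are shown to be constant on a non-empty open set.

   Groebner fan: the initial ideals of all the g(I) have the Hilbert function of
   I, and the monomial ideals with a given Hilbert function are generated in
   bounded degree D (compactness and Dickson's lemma).  So only the finite
   dimensional spaces V_g = g(I)_{<= D} matter.  Let B be a set of monomials such
   that V_g projects isomorphically onto K^B; if B has minimal weight, the initial
   forms of the dual basis of B span the initial space, and whether two weights
   give the same initial space depends only on the supports of this dual basis,
   hence only on which sets B' project isomorphically.  The latter is governed by
   the non-vanishing of determinants that are polynomial in g.

   Monomial-free weights: let r be minimal such that some g(I) + (x_c : c in C),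
   |C| = r, contains a power of the maximal ideal.  For generic g this holds for
   every C with |C| = r, and g(I) meets K[x_c : c in C] trivially (Noether
   normalization).  If at least r coordinates of w are not minimal, a power of a
   minimal variable is an initial form.  Otherwise all non-minimal coordinates lie
   in a set B with |B| = r - 1; an f = x^m + (heavier terms) in g(I) would make some
   monomial E in the variables of C = B + {a} act on the finite K[x_C]-module
   S/g(I) with entries heavier than E, and the determinant trick would yield a
   non-zero element E^k + (heavier terms) of g(I) in K[x_C]. *)

Set Implicit Arguments. Unset Strict Implicit. Unset Printing Implicit Defensive.
Import Order.TTheory GRing.Theory.
(* Reals takes over the key N. *)
Delimit Scope nat_scope with N.
Local Open Scope ring_scope.

(** * Initial ideals, weight by weight *)

HB.instance Definition _ :=
  Monoid.isComLaw.Build R 0%R Rplus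
    (fun x y z => esym (Rplus_assoc x y z)) Rplus_comm Rplus_0_l.

Section Restriction.
Variables (K : fieldType) (n : nat).
Notation P := {mpoly K[n]}.
Implicit Types (p f : P) (m : 'X_{1..n}) (Q : pred 'X_{1..n}).

(** Both [hcomp] and [init_form] unfold to this shape, so their coefficients are read off from
    [mcoeff_mrestr]. *)
Definition mrestr Q f : P := \sum_(m <- msupp f | Q m) f@_m *: 'X_[m].

Lemma mcoeff_mrestr Q f m : (mrestr Q f)@_m = if Q m then f@_m else 0.
Proof.
rewrite /mrestr raddf_sum /=.
have -> : \sum_(i <- msupp f | Q i) (f@_i *: 'X_[i])@_m =
   \sum_(i <- msupp f | Q i && (i == m)) f@_i.
  rewrite big_mkcondr /=; apply: eq_bigr => i _.
  by rewrite mcoeffZ mcoeffX; case: eqP; rewrite ?mulr1 ?mulr0.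
have [mf|mf] := boolP (m \in msupp f); last first.
  rewrite big1_seq ?(memN_msupp_eq0 mf) ?if_same // => i /andP[/andP[_ /eqP->]].
  by rewrite (negPf mf).
case: ifP => Qm.
  rewrite (eq_bigl (pred1 m)) => [|i /=].
    by rewrite -big_filter filter_pred1_uniq ?msupp_uniq // big_seq1.
  by case: eqP => [->|]; rewrite ?Qm ?andbF.
by rewrite big1 // => i /andP[Qi /eqP e]; rewrite e Qm in Qi.
Qed.

Lemma mcoeff_hcomp d f m : (hcomp d f)@_m = if mdeg m == d then f@_m else 0.
Proof. exact: mcoeff_mrestr. Qed.

Lemma mcoeffMX_if p m k :
  (p * 'X_[m])@_k = if (m <= k)%MM then p@_(k - m)%MM else 0.
Proof.
case: ifP => [le|nle]; first by rewrite -{1}(submK le) addmC mcoeffMX.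
apply: memN_msupp_eq0; apply/negP => /msuppM_le /allpairsP[[a b] /= [_]].
by rewrite msuppX inE => /eqP-> e; rewrite e lem_addl in nle.
Qed.

Lemma mcoeffXM_if p m k :
  ('X_[m] * p)@_k = if (m <= k)%MM then p@_(k - m)%MM else 0.
Proof. by rewrite mulrC mcoeffMX_if. Qed.

Lemma msize_leP p (d : nat) : reflect (forall m, p@_m != 0 -> (mdeg m < d)%N) (msize p <= d)%N.
Proof.
apply: (iffP idP) => [le m|h].
  by rewrite -mcoeff_msupp => /msize_mdeg_lt /leq_trans; apply.
have [->|p0] := eqVneq p 0; first by rewrite msize0.
by rewrite -mlead_deg // h // mleadc_eq0.
Qed.

End Restriction.

Section Ideals.
Variables (K : fieldType) (n : nat) (I : {mpoly K[n]} -> Prop).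
Hypothesis Iid : is_ideal I.

Lemma idl0 : I 0. Proof. by case: Iid. Qed.
Lemma idlD f g : I f -> I g -> I (f + g). Proof. by case: Iid => _ h _; apply: h. Qed.
Lemma idlM a f : I f -> I (a * f). Proof. by case: Iid => _ _; apply. Qed.
Lemma idlMr a f : I f -> I (f * a). Proof. by rewrite mulrC; apply: idlM. Qed.
Lemma idlZ c f : I f -> I (c *: f).
Proof. by rewrite -mul_mpolyC; apply: idlM. Qed.
Lemma idlN f : I f -> I (- f).
Proof. by rewrite -scaleN1r; apply: idlZ. Qed.
Lemma idlB f g : I f -> I g -> I (f - g).
Proof. by move=> h1 h2; apply/idlD/idlN. Qed.
Lemma idl_sum (T : eqType) (r : seq T) (Q : pred T) F :
  (forall i, i \in r -> Q i -> I (F i)) -> I (\sum_(i <- r | Q i) F i).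
Proof.
move=> h; rewrite big_seq_cond.
by apply: (big_ind I) => [||i /andP[/h]]; [apply: idl0|apply: idlD|].
Qed.

End Ideals.

Lemma ex_min_seq (T : eqType) (wt : T -> R) (s : seq T) : s != [::] ->
  exists2 m, m \in s & forall m', m' \in s -> (wt m <= wt m')%R.
Proof.
elim: s => [//|a [_ _|b s IH _]].
  by exists a; rewrite ?inE // => m'; rewrite inE => /eqP->; lra.
have [//|m ms hm] := IH.
have [l|l] := Rle_dec (wt a) (wt m).
  exists a; rewrite ?mem_head // => m'; rewrite in_cons => /orP[/eqP->|/hm]; lra.
exists m => [|m']; first by rewrite in_cons ms orbT.
rewrite in_cons => /orP[/eqP->|/hm]; lra.
Qed.

Section Weights.
Variables (K : fieldType) (n : nat).
Notation P := {mpoly K[n]}.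
Implicit Types (p f : P) (m : 'X_{1..n}) (w : 'I_n -> R) (I : P -> Prop).

Lemma wdegD w m1 m2 : wdeg w (m1 + m2)%MM = (wdeg w m1 + wdeg w m2)%R.
Proof.
rewrite /wdeg -big_split /=; apply: eq_bigr => i _.
by rewrite mnmDE plus_INR Rmult_plus_distr_l.
Qed.

Definition req (a b : R) : bool := if Req_EM_T a b then true else false.

Lemma reqP a b : reflect (a = b) (req a b).
Proof. by rewrite /req; case: Req_EM_T => h; constructor. Qed.

Lemma RlebP a b : reflect (a <= b)%R (Rleb a b).
Proof. by rewrite /Rleb; case: Rle_dec => h; constructor. Qed.

Lemma ex_min_weight (wt : 'X_{1..n} -> R) f : f != 0 ->
  exists m, f@_m != 0 /\ forall m', f@_m' != 0 -> (wt m <= wt m')%R.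
Proof.
rewrite -msupp_eq0 => /(ex_min_seq wt)[m ms hm]; exists m; rewrite -mcoeff_msupp.
by split=> // m'; rewrite -mcoeff_msupp; apply: hm.
Qed.

Lemma mcoeff_init_form w f m : f@_m != 0 ->
  (forall m', f@_m' != 0 -> (wdeg w m <= wdeg w m')%R) ->
  forall k, (init_form w f)@_k = if req (wdeg w k) (wdeg w m) then f@_k else 0.
Proof.
move=> fm hm k; rewrite [LHS]mcoeff_mrestr.
have [->|fk] := eqVneq f@_k 0; first by rewrite !if_same.
rewrite (_ : all _ _ = req (wdeg w k) (wdeg w m)) //.
apply/idP/reqP => [/allP|->].
  have h1 := hm k fk; move=> /(_ m); rewrite mcoeff_msupp => /(_ fm) /RlebP; lra.
by apply/allP => m'; rewrite mcoeff_msupp => /hm /RlebP.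
Qed.

Lemma init_form0 w : init_form w 0 = 0 :> P.
Proof. by rewrite /init_form msupp0 big_nil. Qed.

Lemma gen_ideal0 (S : P -> Prop) : gen_ideal S 0.
Proof. by exists 0%N, (fun=> 0), (fun=> 0); split=> [[]//|]; rewrite big_ord0. Qed.

Lemma gen_ideal_gen (S : P -> Prop) p : S p -> gen_ideal S p.
Proof.
by move=> Sp; exists 1%N, (fun=> 1), (fun=> p); rewrite big_ord1 mul1r.
Qed.

Lemma gen_idealD (S : P -> Prop) p q :
  gen_ideal S p -> gen_ideal S q -> gen_ideal S (p + q).
Proof.
move=> [k1 [a1 [s1 [h1 ->]]]] [k2 [a2 [s2 [h2 ->]]]].
exists (k1 + k2)%N, (fun i => match fintype.split i with inl j => a1 j | inr j => a2 j end),
  (fun i => match fintype.split i with inl j => s1 j | inr j => s2 j end).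
split; first by move=> i; case: fintype.split.
rewrite big_split_ord /=; congr (_ + _); apply: eq_bigr => i _.
  by rewrite (unsplitK (inl i)).
by rewrite (unsplitK (inr i)).
Qed.

(* The weight-homogeneous components of an element of the initial ideal are
   themselves initial forms, which makes membership checkable weight by weight. *)
Lemma init_idealP w I p : is_ideal I ->
  init_ideal w I p <-> forall om, exists f, [/\ I f,
    (forall m, (wdeg w m < om)%R -> f@_m = 0) &
    (forall m, wdeg w m = om -> f@_m = p@_m)].
Proof.
move=> Iid; split.
- move=> [k [a [s [hs ->]]]].
  set L := fun q : P => forall om, exists f, [/\ I f,
    (forall m, (wdeg w m < om)%R -> f@_m = 0) &
    (forall m, wdeg w m = om -> f@_m = q@_m)].
  have L0 : L 0.
    by move=> om; exists 0; split=> [|m _|m _]; rewrite ?mcoeff0 //; apply: idl0.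
  have LD q1 q2 : L q1 -> L q2 -> L (q1 + q2).
    move=> h1 h2 om; have [f1 [I1 l1 e1]] := h1 om; have [f2 [I2 l2 e2]] := h2 om.
    exists (f1 + f2); split=> [|m h|m h]; first exact: idlD.
      by rewrite mcoeffD l1 ?l2 ?addr0.
    by rewrite !mcoeffD e1 ?e2.
  apply: (big_ind L L0 LD) => i _; have [f [If ->]] := hs i.
  have [->|f0] := eqVneq f 0; first by rewrite init_form0 mulr0.
  have [m0 [fm0 hm0]] := ex_min_weight (wdeg w) f0.
  have ei := mcoeff_init_form fm0 hm0.
  (* A monomial multiple of an initial form lives in a single weight, so it needs a non-trivial lift
     at that weight only; elsewhere [0] serves. *)
  rewrite [a i]mpolyE mulr_suml; apply: (big_ind L L0 LD) => m _ om.
  have [e|ne] := Req_EM_T (wdeg w m + wdeg w m0)%R om; last first.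
    exists 0; split=> [|m' _|m' h]; rewrite ?mcoeff0 //; first exact: idl0.
    rewrite -scalerAl mcoeffZ mcoeffXM_if ei; case: ifP => [le|]; rewrite ?mulr0 //.
    case: reqP => [e|]; rewrite ?mulr0 //.
    by case: ne; rewrite -e -h -wdegD addmC submK.
  exists ((a i)@_m *: 'X_[m] * f); split=> [|m' h|m' h]; first exact: idlM.
    rewrite -scalerAl mcoeffZ mcoeffXM_if; case: ifP => [le|]; rewrite ?mulr0 //.
    have [->|/hm0 l] := eqVneq f@_(m' - m)%MM 0; rewrite ?mulr0 //.
    move: h; rewrite -(submK le) wdegD; lra.
  rewrite -!scalerAl !mcoeffZ !mcoeffXM_if; case: ifP => [le|] //.
  congr (_ * _); rewrite ei; case: reqP => // ne; case: ne.
  move: h; rewrite -{1}(submK le) wdegD; lra.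
(* Conversely, the lowest-weight component of [p] is an initial form; subtracting it shrinks the
   support, whence the induction on its size. *)
- have [k] := ubnP (size (msupp p)); elim: k p => [//|k IH] p lt h.
  have [->|p0] := eqVneq p 0; first exact: gen_ideal0.
  have [m0 [pm0 hm0]] := ex_min_weight (wdeg w) p0.
  have [f [If f_lt f_eq]] := h (wdeg w m0).
  have fm0 : f@_m0 != 0 by rewrite f_eq.
  have hf m' : f@_m' != 0 -> (wdeg w m0 <= wdeg w m')%R.
    move=> f0; apply: Rnot_lt_le => /f_lt e; by rewrite e eqxx in f0.
  have ei := mcoeff_init_form fm0 hf.
  have ep m : (p - init_form w f)@_m = if req (wdeg w m) (wdeg w m0) then 0 else p@_m.
    by rewrite mcoeffB ei; case: reqP => [e|]; rewrite ?subr0 // f_eq ?subrr.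
  rewrite -(subrK (init_form w f) p); apply: gen_idealD; last first.
    by apply: gen_ideal_gen; exists f.
  apply: IH => [|om].
    apply: leq_trans (lt : (size (msupp p) <= k)%N).
    apply: (@uniq_leq_size _ (m0 :: msupp (p - init_form w f))) => [|m].
      rewrite /= msupp_uniq andbT mcoeff_msupp ep; case: reqP => [_|[]//].
      by rewrite eqxx.
    rewrite in_cons => /orP[/eqP->|]; first by rewrite mcoeff_msupp.
    by rewrite !mcoeff_msupp ep; case: ifP => // _; rewrite eqxx.
  have [->|ne] := Req_EM_T om (wdeg w m0).
    exists 0; split=> [|m _|m e]; rewrite ?mcoeff0 //; first exact: idl0.
    by rewrite ep; case: reqP.
  have [g [Ig l e]] := h om; exists g; split=> // m em; rewrite ep e //.
  by case: reqP => // em'; case: ne; rewrite -em.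
Qed.

Lemma init_ideal_ideal w I : is_ideal (init_ideal w I).
Proof.
split; [exact: gen_ideal0|exact: gen_idealD|move=> a f [k [b [s [hs ->]]]]].
exists k, (fun i => a * b i), s; split=> //.
by rewrite mulr_sumr; apply: eq_bigr => i _; rewrite mulrA.
Qed.

End Weights.

(** * Coordinate bases of spaces of polynomials *)

Section Bases.
Variables (K : fieldType) (n : nat).
Notation P := {mpoly K[n]}.
Implicit Types (p f : P) (m b : 'X_{1..n}) (V : P -> Prop) (B : seq 'X_{1..n}).

Definition is_subspace V := V 0 /\ forall c f g, V f -> V g -> V (c *: f + g).

Lemma subspaceD V f g : is_subspace V -> V f -> V g -> V (f + g).
Proof. by move=> [_ h] Vf Vg; rewrite -[f]scale1r; apply: h. Qed.

Lemma subspaceZ V c f : is_subspace V -> V f -> V (c *: f).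
Proof. by move=> [V0 h] Vf; rewrite -[_ *: _]addr0; apply: h. Qed.

Lemma subspaceB V f g : is_subspace V -> V f -> V g -> V (f - g).
Proof. by move=> Vs Vf Vg; rewrite addrC -scaleN1r; apply: (proj2 Vs). Qed.

Lemma subspace_sum V (T : eqType) (r : seq T) (F : T -> P) : is_subspace V ->
  (forall i, i \in r -> V (F i)) -> V (\sum_(i <- r) F i).
Proof.
move=> Vs h; rewrite big_seq.
by apply: (big_ind V) => // [|f g]; [case: Vs|apply: subspaceD].
Qed.

Definition is_dual B b f := forall m, m \in B -> f@_m = (m == b)%:R.

(* [B] indexes a set of coordinates on which [V] projects isomorphically,
   i.e. a basis of the matroid of [V]. *)
Definition is_basis V B := [/\ uniq B,
  forall f, V f -> (forall m, m \in B -> f@_m = 0) -> f = 0 &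
  forall b, b \in B -> exists f, V f /\ is_dual B b f].

Lemma basis_inj V B f g : is_subspace V -> is_basis V B -> V f -> V g ->
  (forall m, m \in B -> f@_m = g@_m) -> f = g.
Proof.
move=> Vs [_ inj _] Vf Vg e; apply/eqP; rewrite -subr_eq0; apply/eqP.
by apply: inj; [exact: subspaceB|move=> m /e; rewrite mcoeffB => ->; rewrite subrr].
Qed.

Lemma basis_family V B : is_basis V B ->
  exists v : 'I_(size B) -> P, forall i, V (v i) /\
    forall j : 'I_(size B), (v i)@_(nth 0%MM B j) = (i == j)%:R.
Proof.
move=> [uB _ dB].
have h (i : 'I_(size B)) : exists f, V f /\
    forall j : 'I_(size B), f@_(nth 0%MM B j) = (i == j)%:R.
  have [f [Vf df]] := dB _ (mem_nth 0%MM (ltn_ord i)).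
  exists f; split=> // j; rewrite df ?mem_nth //.
  by rewrite nth_uniq // eq_sym.
by have [v hv] := fin_all_exists h; exists v.
Qed.

Lemma expand_family V B (v : 'I_(size B) -> P) f : is_subspace V -> is_basis V B ->
  (forall i, V (v i) /\
    forall j : 'I_(size B), (v i)@_(nth 0%MM B j) = (i == j)%:R) ->
  V f -> f = \sum_(i < size B) f@_(nth 0%MM B i) *: v i.
Proof.
move=> Vs Bb hv Vf; apply: (basis_inj Vs Bb) => //.
  apply: subspace_sum => // i _; apply: subspaceZ => //; by case: (hv i).
move=> m mB; have lt : (index m B < size B)%N by rewrite index_mem.
rewrite -(nth_index 0%MM mB) raddf_sum /= (bigD1 (Ordinal lt)) //= big1.
  rewrite addr0 mcoeffZ; have [_ /(_ (Ordinal lt)) /= ->] := hv (Ordinal lt).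
  by rewrite eqxx mulr1.
move=> i ne; rewrite mcoeffZ; have [_ /(_ (Ordinal lt)) /= ->] := hv i.
by rewrite (negPf ne) mulr0.
Qed.

(** Matroid exchange: the coefficients of a dual vector off [B] record which swaps give a basis
    again. Hence the family of bases determines the supports of all dual vectors. *)
Lemma dual_exchange V B b f m : is_subspace V -> is_basis V B ->
  b \in B -> V f -> is_dual B b f -> m \notin B ->
  is_basis V (m :: rem b B) <-> f@_m != 0.
Proof.
move=> Vs Bb bB Vf df mB; have [uB injB dB] := Bb.
have nz k : k \in rem b B -> (k \in B) && (k != b).
  by rewrite mem_rem_uniq // => /andP[h1 h2]; rewrite h2 h1.
split.
- move=> [_ inj _]; apply/eqP=> fm.
  have f0 : f = 0.
    apply: inj => // k; rewrite in_cons => /orP[/eqP->//|/nz/andP[kB kb]].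
    by rewrite df // (negPf kb).
  have := df b bB; rewrite f0 mcoeff0 eqxx => /esym/eqP; by rewrite oner_eq0.
- move=> fm; split.
  + by rewrite /= rem_uniq // andbT; apply: contra mB => /nz/andP[].
  + move=> g Vg g0.
    have e : g = g@_b *: f.
      apply: (basis_inj Vs Bb) => //; first exact: subspaceZ.
      move=> k kB; rewrite mcoeffZ df //; have [->|kb] := eqVneq k b.
        by rewrite mulr1.
      rewrite mulr0 g0 // in_cons mem_rem_uniq // inE kb kB orbT //.
    have := g0 m (mem_head _ _); rewrite e mcoeffZ => /eqP.
    by rewrite mulf_eq0 (negPf fm) orbF => /eqP->; rewrite scale0r.
  + move=> c; rewrite in_cons => /orP[/eqP->|/nz/andP[cB cb]].
      exists ((f@_m)^-1 *: f); split; first exact: subspaceZ.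
      move=> k; rewrite mcoeffZ in_cons => /orP[/eqP->|/nz/andP[kB kb]].
        by rewrite mulVf ?eqxx.
      have km : k != m by apply: contraNneq mB => <-.
      by rewrite (df k kB) (negPf kb) (negPf km) mulr0.
    have [g [Vg dg]] := dB c cB.
    exists (g - (g@_m / f@_m) *: f); split.
      by apply: subspaceB => //; apply: subspaceZ.
    have cm : c != m by apply: contraNneq mB => <-.
    move=> k; rewrite mcoeffB mcoeffZ in_cons => /orP[/eqP->|/nz/andP[kB kb]].
      by rewrite divfK // subrr eq_sym (negPf cm).
    by rewrite (dg k kB) (df k kB) (negPf kb) mulr0 subr0.
Qed.

(** Greedy elimination along [s]: a basis for the vectors vanishing at the first entry [a] is found
    by induction, and [a] is added when some vector of [V] does not vanish there. As [s] is sorted,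
    every dual vector starts at its own index. *)
Lemma basis_exists V (leT : rel 'X_{1..n}) (s : seq 'X_{1..n}) :
  is_subspace V -> reflexive leT -> transitive leT -> uniq s -> sorted leT s ->
  (forall f m, V f -> f@_m != 0 -> m \in s) ->
  exists B, is_basis V B /\ forall b, b \in B -> exists f,
     [/\ V f, is_dual B b f & forall m, f@_m != 0 -> leT b m].
Proof.
move=> Vs refl trans; elim: s V Vs => [|a s IH] V Vs us ss hs.
  exists [::]; split=> //; split=> // f Vf _; apply/mpolyP=> m; rewrite mcoeff0.
  by apply/eqP; apply/negP=> /negP /(hs _ _ Vf).
pose V' f := V f /\ f@_a = 0.
have V's : is_subspace V'.
  split; first by split; [case: Vs|rewrite mcoeff0].
  move=> c f g [Vf fa] [Vg ga]; split; first exact: (proj2 Vs).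
  by rewrite mcoeffD mcoeffZ fa ga mulr0 addr0.
have [/= aNs us'] := andP us.
have [||f m [Vf fa] fm|B [Bb hB]] := IH V' V's => //; first exact: path_sorted ss.
  have := hs f m Vf fm; rewrite in_cons => /orP[/eqP e|//].
  by rewrite e fa eqxx in fm.
have [uB injB dB] := Bb.
have hBV b : b \in B -> b != a.
  move=> bB; have [f [[_ fa] df _]] := hB b bB; apply/eqP => e.
  have := df b bB; rewrite {1}e fa eqxx => /esym/eqP; by rewrite oner_eq0.
have [[f [Vf fa]]|no] := classic (exists f, V f /\ f@_a != 0); last first.
  exists B; split.
    split=> // [f Vf|b /dB[f [[Vf _] df]]]; last by exists f.
    apply: injB; split=> //; apply/eqP/negP=> /negP fa; by case: no; exists f.
  by move=> b /hB[f [[Vf _] df l]]; exists f.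
have [v hv] := basis_family Bb.
have [g Vg ga] : exists2 g, V g & g@_a = 1.
  by exists ((f@_a)^-1 *: f); rewrite ?mcoeffZ ?mulVf //; apply: subspaceZ.
(* Subtracting dual vectors clears the coordinates in [B]; they vanish at [a], so the coefficient
   [1] there survives. *)
pose h := g - \sum_(i < size B) g@_(nth 0%MM B i) *: v i.
have Vh : V h.
  apply: subspaceB => //; apply: subspace_sum => // i _; apply: subspaceZ => //.
  by case: (hv i) => -[].
have ha : h@_a = 1.
  rewrite mcoeffB ga raddf_sum /= big1 ?subr0 // => i _.
  by rewrite mcoeffZ; case: (hv i) => -[_ ->]; rewrite mulr0.
have hB0 m : m \in B -> h@_m = 0.
  move=> mB; have lt : (index m B < size B)%N by rewrite index_mem.
  rewrite -(nth_index 0%MM mB) mcoeffB raddf_sum /= (bigD1 (Ordinal lt)) //= big1.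
    rewrite addr0 mcoeffZ; have [_ /(_ (Ordinal lt)) /= ->] := hv (Ordinal lt).
    by rewrite eqxx mulr1 subrr.
  move=> i ne; rewrite mcoeffZ; have [_ /(_ (Ordinal lt)) /= ->] := hv i.
  by rewrite (negPf ne) mulr0.
have dh : is_dual (a :: B) a h.
  move=> m; rewrite in_cons => /orP[/eqP->|mB]; first by rewrite ha eqxx.
  by rewrite hB0 // (negPf (hBV m mB)).
have dual' b f' : b \in B -> V' f' -> is_dual B b f' -> is_dual (a :: B) b f'.
  move=> bB [_ f'a] df m; rewrite in_cons => /orP[/eqP->|/df//].
  by rewrite f'a eq_sym (negPf (hBV b bB)).
exists (a :: B); split.
  split.
  - by rewrite /= uB andbT; apply/negP=> /hBV; rewrite eqxx.
  - move=> k Vk k0; apply: injB; first by split; rewrite ?k0 ?mem_head.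
    by move=> m mB; rewrite k0 // in_cons mB orbT.
  - move=> b; rewrite in_cons => /orP[/eqP->|bB]; first by exists h.
    by have [f' [V'f' df']] := dB b bB; exists f'; split; [case: V'f'|apply: dual'].
move=> b; rewrite in_cons => /orP[/eqP->|bB].
  exists h; split=> // m hm; have := hs _ _ Vh hm.
  rewrite in_cons => /orP[/eqP->|ms]; first exact: refl.
  by have /allP := order_path_min trans ss; apply.
have [f' [V'f' df' l]] := hB b bB.
by exists f'; split=> //; [case: V'f'|apply: dual'].
Qed.

Definition basis_matrix k k' (v : 'I_k -> P) (phi : P -> P) (e : 'I_k' -> 'X_{1..n}) :=
  \matrix_(i < k, j < k') (phi (v i))@_(e j).

Lemma basis_matrixE k k' (v : 'I_k -> P) (phi : {linear P -> P})
    (e : 'I_k' -> 'X_{1..n}) (u : 'rV[K]_k) j :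
  (u *m basis_matrix v phi e) 0 j = (phi (\sum_i u 0 i *: v i))@_(e j).
Proof.
rewrite !mxE linear_sum raddf_sum /=; apply: eq_bigr => i _.
by rewrite mxE linearZ /= mcoeffZ.
Qed.

Section Transport.
Variables (V V' : P -> Prop) (phi : {linear P -> P}) (B : seq 'X_{1..n}).
Variable v : 'I_(size B) -> P.
Hypotheses (Vs : is_subspace V) (Vs' : is_subspace V') (Bb : is_basis V B).
Hypotheses (VV' : forall f, V f -> V' (phi f)) (phiI : forall f, V f -> phi f = 0 -> f = 0).
Hypothesis hv : forall i, V (v i) /\
    forall j : 'I_(size B), (v i)@_(nth 0%MM B j) = (i == j)%:R.

Let Vsum (u : 'I_(size B) -> K) : V (\sum_i u i *: v i).
Proof. by apply: subspace_sum => // i _; apply: subspaceZ => //; case: (hv i). Qed.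

Lemma family_free (u : 'I_(size B) -> K) : \sum_i u i *: v i = 0 -> forall i, u i = 0.
Proof.
move=> e i; have := congr1 (mcoeff (nth 0%MM B i)) e.
rewrite mcoeff0 raddf_sum /= (bigD1 i) //= big1 ?addr0 => [|j ne].
  by rewrite mcoeffZ; case: (hv i) => _ ->; rewrite eqxx mulr1.
by rewrite mcoeffZ; case: (hv j) => _ ->; rewrite (negPf ne) mulr0.
Qed.

(** A vector in the left kernel gives an element of [V] whose image vanishes at all the coordinates
    [e], hence is zero. *)
Lemma basis_row_free k (e : 'I_k -> 'X_{1..n}) :
  (forall f, V' f -> (forall j, f@_(e j) = 0) -> f = 0) ->
  row_free (basis_matrix v phi e).
Proof.
move=> inj; apply: inj_row_free => u u0.
have /phiI/family_free : phi (\sum_i u 0 i *: v i) = 0.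
  by apply: inj => [|j]; [exact: VV'|rewrite -basis_matrixE u0 mxE].
by move=> h; apply/rowP=> i; rewrite mxE h.
Qed.

Lemma basis_size_le B' : is_basis V' B' -> (size B <= size B')%N.
Proof.
move=> [uB' inj _].
have : row_free (basis_matrix v phi (fun j : 'I_(size B') => nth 0%MM B' j)).
  apply: basis_row_free => f Vf f0; apply: inj => // m mB.
  have lt : (index m B' < size B')%N by rewrite index_mem.
  by have := f0 (Ordinal lt); rewrite /= nth_index.
by rewrite -row_leq_rank => /leq_trans; apply; apply: rank_leq_col.
Qed.

(** For [phi] equal to [gact g] the determinant is polynomial in [g]; this is what makes being a
    basis an open condition. *)
Lemma basis_det B' : (forall f, V' f -> exists2 h, V h & f = phi h) ->
  uniq B' -> size B' = size B ->
  is_basis V' B' <->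
  \det (basis_matrix v phi (fun j : 'I_(size B) => nth 0%MM B' j)) != 0.
Proof.
move=> sur uB' sB'; set M := basis_matrix _ _ _.
split.
  move=> [_ inj _]; rewrite -unitfE -[_ \is a _]/(M \in unitmx) -row_free_unit.
  apply: basis_row_free => f Vf f0; apply: inj => // m mB.
  have lt : (index m B' < size B)%N by rewrite -sB' index_mem.
  by have := f0 (Ordinal lt); rewrite /= nth_index.
rewrite -unitfE -[_ \is a _]/(M \in unitmx) => uM.
split=> //.
- move=> f /sur[h Vh ->] f0.
  rewrite (expand_family Vs Bb hv Vh); pose u := \row_(i < size B) h@_(nth 0%MM B i).
  suff -> : h = 0 by rewrite big1 ?linear0 // => i _; rewrite mcoeff0 scale0r.
  have u0 : u = 0.
    apply: (can_inj (mulmxK uM)); rewrite mul0mx; apply/rowP=> j.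
    rewrite basis_matrixE mxE; under eq_bigr do rewrite mxE.
    by rewrite -(expand_family Vs Bb hv Vh) f0 // mem_nth // sB'.
  rewrite (expand_family Vs Bb hv Vh) big1 // => i _.
  by move/rowP: u0 => /(_ i); rewrite !mxE => ->; rewrite scale0r.
- move=> b bB; have lt : (index b B' < size B)%N by rewrite -sB' index_mem.
  pose u := row (Ordinal lt) (invmx M).
  exists (phi (\sum_i u 0 i *: v i)); split; first exact: VV'.
  move=> m mB; have ltm : (index m B' < size B)%N by rewrite -sB' index_mem.
  rewrite -{1}(nth_index 0%MM mB) -[index m B']/(val (Ordinal ltm)).
  have := basis_matrixE v phi (fun j : 'I_(size B) => nth 0%MM B' j) u (Ordinal ltm).
  rewrite /= => <-; rewrite -/M -row_mul mulVmx // !mxE; congr (_%:R); congr nat_of_bool.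
  rewrite -val_eqE /=; apply/eqP/eqP => [e|->//].
  by rewrite -(nth_index 0%MM mB) -(nth_index 0%MM bB) e.
Qed.

End Transport.

Lemma basis_size_eq V B B' : is_subspace V -> is_basis V B -> is_basis V B' ->
  size B = size B'.
Proof.
move=> Vs Bb Bb'; have [v hv] := basis_family Bb; have [v' hv'] := basis_family Bb'.
apply/eqP; rewrite eqn_leq.
have /= h1 := @basis_size_le V V idfun B v Vs (fun f Vf => Vf) (fun f _ e => e) hv.
by rewrite h1 //= (@basis_size_le V V idfun B' v' Vs (fun f Vf => Vf) (fun f _ e => e) hv').
Qed.

End Bases.

(** * The action of matrices *)

Section Action.
Variables (K : fieldType) (n : nat).
Notation P := {mpoly K[n]}.
Implicit Types (p f : P) (m : 'X_{1..n}) (g h : 'M[K]_n).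

Definition subst_tuple g : n.-tuple P := [tuple \sum_(j < n) g i j *: 'X_j | i < n].

HB.instance Definition _ g := GRing.Linear.copy (gact g) (comp_mpoly (subst_tuple g)).
HB.instance Definition _ g := GRing.RMorphism.copy (gact g) (comp_mpoly (subst_tuple g)).

Lemma gactP g c f p : gact g (c *: f + p) = c *: gact g f + gact g p.
Proof. exact: linearP. Qed.

Lemma gactXU g i : gact g 'X_i = \sum_(j < n) g i j *: 'X_j.
Proof. by rewrite /gact comp_mpolyXU -tnth_nth tnth_mktuple. Qed.

Lemma gactXm g m : gact g 'X_[m] = \prod_(i < n) (gact g 'X_i) ^+ m i.
Proof. by rewrite mpolyXE_id rmorph_prod; apply: eq_bigr => i _; rewrite rmorphXn. Qed.

(** Ring morphisms are compared on variables. The matrices multiply in the order of application, so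
    this is a right action. *)
Lemma gact_comp g h f : gact h (gact g f) = gact (g *m h) f.
Proof.
have eU i : gact h (gact g 'X_i) = gact (g *m h) 'X_i.
  rewrite !gactXU (linear_sum (gact h)) /=.
  under eq_bigr do rewrite linearZ /= gactXU scaler_sumr.
  rewrite exchange_big /=; apply: eq_bigr => k _; rewrite !mxE scaler_suml.
  by apply: eq_bigr => j _; rewrite scalerA.
have eX m : gact h (gact g 'X_[m]) = gact (g *m h) 'X_[m].
  rewrite !gactXm (rmorph_prod (gact h)); apply: eq_bigr => i _.
  by rewrite (rmorphXn (gact h)) /= eU.
elim/mpolyind: f => [|c m f _ _ IH]; first by rewrite !linear0.
by rewrite !gactP IH eX.
Qed.

Lemma gact1 f : gact 1%:M f = f.
Proof.
have eU i : gact 1%:M 'X_i = 'X_i :> P.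
  rewrite gactXU (bigD1 i) //= mxE eqxx scale1r big1 ?addr0 // => j ne.
  by rewrite mxE eq_sym (negPf ne) scale0r.
elim/mpolyind: f => [|c m f _ _ IH]; first by rewrite linear0.
rewrite gactP IH gactXm mpolyXE_id.
by under eq_bigr do rewrite eU.
Qed.

Lemma gactK g : g \in unitmx -> cancel (gact g) (gact (invmx g)).
Proof. by move=> u f; rewrite gact_comp mulmxV // gact1. Qed.

Lemma gactVK g : g \in unitmx -> cancel (gact (invmx g)) (gact g).
Proof. by move=> u f; rewrite gact_comp mulVmx // gact1. Qed.

Lemma gactX_homog g m m' : (gact g 'X_[m])@_m' != 0 -> mdeg m' = mdeg m.
Proof.
have h : forall (s : seq 'I_n), \prod_(i <- s) (gact g 'X_i) ^+ m i
    \is (\sum_(i <- s) m i).-homog.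
  elim=> [|i s IH]; first by rewrite !big_nil dhomog1.
  rewrite !big_cons; apply: dhomogM => //.
  have := @dhomogMn _ _ mdeg 1 (gact g 'X_i) (m i); rewrite mul1n; apply; rewrite gactXU.
  by apply: rpred_sum => j _; apply: rpredZ; rewrite dhomogX /= mdeg1.
by rewrite gactXm -mcoeff_msupp (mdegE m) => /(dhomog_mf (h _)).
Qed.

Lemma mrestr_linear (Q : pred 'X_{1..n}) c f p :
  mrestr Q (c *: f + p) = c *: mrestr Q f + mrestr Q p.
Proof.
 apply/mpolyP=> m.
rewrite mcoeffD mcoeffZ !mcoeff_mrestr mcoeffD mcoeffZ.
by case: ifP; rewrite ?mulr0 ?addr0.
Qed.

Lemma hcomp_gact g d f : hcomp d (gact g f) = gact g (hcomp d f).
Proof.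
elim/mpolyind: f => [|c m f _ _ IH].
  by rewrite !linear0 /hcomp !msupp0 !big_nil linear0.
rewrite linearP /= [LHS]mrestr_linear [hcomp d (_ + _)]mrestr_linear linearP /=.
congr (_ *: _ + _) => //; apply/mpolyP=> k; rewrite mcoeff_mrestr.
have -> : mrestr (fun m0 => mdeg m0 == d) 'X_[m] =
    if mdeg m == d then 'X_[m] else 0 :> P.
  apply/mpolyP=> k'; rewrite mcoeff_mrestr; have [->|ne] := eqVneq m k'.
    by case: ifP; rewrite ?mcoeff0.
  by rewrite mcoeffX (negPf ne) if_same; case: ifP; rewrite ?mcoeff0 // mcoeffX (negPf ne).
have [e|ne] := eqVneq (gact g 'X_[m])@_k 0.
  by rewrite e if_same; case: ifP; rewrite ?linear0 ?mcoeff0.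
by rewrite (gactX_homog ne); case: ifP => //; rewrite linear0 mcoeff0.
Qed.

Lemma gact_msize g f (d : nat) : (msize f <= d)%N -> (msize (gact g f) <= d)%N.
Proof.
move/msize_leP => h; apply/msize_leP => m.
rewrite [in gact g f](mpolyE f) (linear_sum (gact g)) (raddf_sum (mcoeff m)) => ne.
have [k kf] : exists2 k, k \in msupp f & (gact g 'X_[k])@_m != 0.
  apply: NNPP => no; case/eqP: ne; rewrite big_seq big1 // => k kf.
  rewrite linearZ /= mcoeffZ; have [->|h'] := eqVneq (gact g 'X_[k])@_m 0.
    by rewrite mulr0.
  by case: no; exists k.
by move/gactX_homog => ->; apply: h; rewrite -mcoeff_msupp.
Qed.

Lemma ideal_actE g (I : P -> Prop) f : g \in unitmx ->
  ideal_act g I f <-> I (gact (invmx g) f).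
Proof.
move=> u; split=> [[h [Ih ->]]|If]; first by rewrite gactK.
by exists (gact (invmx g) f); rewrite gactVK.
Qed.

Lemma ideal_act_ideal g I : g \in unitmx -> is_ideal I -> is_ideal (ideal_act g I).
Proof.
move=> u Iid; split.
- by exists 0; rewrite linear0; split=> //; apply: idl0.
- by move=> _ _ [f [If ->]] [h [Ih ->]]; exists (f + h); rewrite linearD; split=> //; apply: idlD.
- move=> a _ [f [If ->]]; exists (gact (invmx g) a * f).
  by rewrite rmorphM /= gactVK //; split=> //; apply: idlM.
Qed.

Lemma ideal_act_graded g I : g \in unitmx -> is_graded_ideal I ->
  is_graded_ideal (ideal_act g I).
Proof.
move=> u [Iid hI]; split; first exact: ideal_act_ideal.
by move=> _ d [f [If ->]]; exists (hcomp d f); rewrite hcomp_gact; split=> //; apply: hI.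
Qed.

Lemma ideal_act_comp g h I : ideal_act h (ideal_act g I) = ideal_act (g *m h) I.
Proof.
apply: functional_extensionality => p.
apply: propositional_extensionality; split.
  by move=> [_ [[f [If ->]] ->]]; exists f; rewrite gact_comp.
by move=> [f [If ->]]; exists (gact g f); rewrite gact_comp; split=> //; exists f.
Qed.

End Action.

(** * Degree-bounded parts of ideals *)

Section BoundedPart.
Variables (K : fieldType) (n : nat).
Notation P := {mpoly K[n]}.
Implicit Types (p f : P) (m : 'X_{1..n}) (I : P -> Prop).

(** [msize] exceeds the degree of a nonzero polynomial by one, so this is the part of degree
    strictly below [d]. *)
Definition bounded_part (d : nat) I : P -> Prop := fun f => I f /\ (msize f <= d)%N.

Lemma bounded_part_subspace d I : is_ideal I -> is_subspace (bounded_part d I).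
Proof.
move=> Iid; split; first by split; [exact: idl0|rewrite msize0].
move=> c f g [If df] [Ig dg]; split; first by apply: idlD => //; apply: idlZ.
apply: (leq_trans (msizeD_le _ _)); rewrite geq_max dg andbT.
exact: leq_trans (mmeasureZ_le _ _ _) df.
Qed.

Definition monomials (d : nat) : seq 'X_{1..n} := map val (enum {: 'X_{1..n < d}}).

Lemma mem_monomials d m : (m \in monomials d) = (mdeg m < d)%N.
Proof.
apply/mapP/idP => [[k _ ->]|lt]; first exact: bmdeg.
by exists (BMultinom lt) => //; rewrite mem_enum.
Qed.

Lemma monomials_uniq d : uniq (monomials d).
Proof. by rewrite map_inj_uniq ?enum_uniq //; apply: val_inj. Qed.

Lemma bounded_part_basis (leT : rel 'X_{1..n}) d I : is_ideal I ->
  total leT -> transitive leT ->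
  exists B, is_basis (bounded_part d I) B /\ forall b, b \in B -> exists f,
     [/\ bounded_part d I f, is_dual B b f & forall m, f@_m != 0 -> leT b m].
Proof.
move=> Iid tot tr; apply: (@basis_exists _ _ _ leT (sort leT (monomials d))) => //.
- exact: bounded_part_subspace.
- by move=> m; have := tot m m; rewrite orbb.
- by rewrite sort_uniq monomials_uniq.
- exact: sort_sorted.
- by move=> f m [_ /msize_leP h] /h; rewrite mem_sort mem_monomials.
Qed.

Lemma ideal_act_bounded (g : 'M[K]_n) I d f : g \in unitmx ->
  bounded_part d (ideal_act g I) f <->
  exists2 h, bounded_part d I h & f = gact g h.
Proof.
move=> u; split=> [[[h [Ih ->]] d'] |[h [Ih dh] ->]]; last first.
  by split; [exists h|exact: gact_msize].
by exists h => //; split=> //; rewrite -(gactK u h); apply: gact_msize.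
Qed.

End BoundedPart.

(** * Dickson's lemma and uniform degree bounds *)

Lemma uniform_bound (Q : nat -> nat -> Prop) (b : nat) :
  (forall v D D', (D <= D')%N -> Q v D -> Q v D') ->
  (forall v, (v < b)%N -> exists D, Q v D) ->
  exists D, forall v, (v < b)%N -> Q v D.
Proof.
move=> mono; elim: b => [_|b IH h]; first by exists 0%N.
have [v lt|D1 h1] := IH; first by apply: h; lia.
have [D2 h2] := h b (ltnSn b); exists (maxn D1 D2) => v lt.
have [->|ne] := eqVneq v b; first by apply: mono h2; lia.
by apply: (mono v D1); [lia|apply: h1; lia].
Qed.

(** Induction on the number [k] of coordinates in which divisibility is required. A witness for the
    first [k] coordinates can fail at the next one only if [m] has there one of the finitely many
    values up to [D0]; each such slice has its own bound. *)
Lemma dickson n (S : 'X_{1..n} -> Prop) : exists D : nat, forall m, S m ->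
  exists m', [/\ S m', (m' <= m)%MM & (mdeg m' <= D)%N].
Proof.
have h (k : nat) : forall S : 'X_{1..n} -> Prop, exists D : nat, forall m, S m ->
    exists m', [/\ S m', forall i : 'I_n, (i < k)%N -> (m' i <= m i)%N & (mdeg m' <= D)%N].
  elim: k => [|k IH] {}S.
    have [[m0 Sm0]|no] := classic (exists m, S m).
      by exists (mdeg m0) => m _; exists m0.
    by exists 0%N => m Sm; case: no; exists m.
  have [lt|ge] := ltnP k n; last first.
    have [D hD] := IH S; exists D => m /hD[m' [Sm' le d]]; exists m'; split=> // i _.
    by apply: le; apply: leq_trans (ltn_ord i) ge.
  pose i0 := Ordinal lt; have [D0 h0] := IH S.
  pose Q v (D : nat) := forall m, S m -> m i0 = v -> exists m',
    [/\ S m', forall i : 'I_n, (i < k.+1)%N -> (m' i <= m i)%N & (mdeg m' <= D)%N].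
  have [v D D' le q m Sm e|v _|D hD] := @uniform_bound Q D0.+1.
  - by have [m' [? ? ?]] := q m Sm e; exists m'; split=> //; lia.
  - have [D hD] := IH (fun m => S m /\ m i0 = v); exists D => m Sm e.
    have [//|m' [[Sm' e'] le d]] := hD m; exists m'; split=> // i.
    rewrite ltnS leq_eqVlt => /orP[/eqP ei|/le//].
    by have -> : i = i0 by [apply: val_inj]; rewrite e e'.
  exists (maxn D0 D) => m Sm; have [m' [Sm' le d]] := h0 m Sm.
  have [le0|gt0] := leqP (m' i0) (m i0).
    exists m'; split=> //; last by lia.
    move=> i; rewrite ltnS leq_eqVlt => /orP[/eqP ei|/le//].
    by have -> : i = i0 by [apply: val_inj].
  have [|m'' [? ? ?]] := hD (m i0) _ m Sm erefl; last by exists m''; split=> //; lia.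
  rewrite ltnS; apply: leq_trans (ltnW gt0) _; apply: leq_trans d.
  by rewrite mdegE (bigD1 i0) //= leq_addr.
have [D hD] := h n S; exists D => m /hD[m' [? le ?]]; exists m'; split=> //.
by apply/mnm_lepP => i; apply: le.
Qed.

(* The limit predicate is built by deciding the elements in the order of their
   codes, keeping [True] as long as this leaves approximants for every [D]. *)
Lemma compactness (T : countType) (Q : nat -> (T -> Prop) -> Prop) :
  (forall D D' M, (D <= D')%N -> Q D' M -> Q D M) -> (forall D, exists M, Q D M) ->
  exists X : T -> Prop, forall (s : seq T) D,
    exists M, Q D M /\ forall t, t \in s -> (M t <-> X t).
Proof.
move=> mono ne.
pose good k (X : nat -> Prop) := forall D, exists M, Q D M /\
  forall t, (pickle t < k)%N -> (M t <-> X (pickle t)).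
pose upd (X : nat -> Prop) k (b : Prop) := fun i : nat => if i == k then b else X i.
pose Xs := fix Xs k := if k is k'.+1
  then upd (Xs k') k' (good k'.+1 (upd (Xs k') k' True)) else fun=> True.
have goodX k : good k (Xs k).
  elim: k => [D|k IH]; first by have [M] := ne D; exists M.
  rewrite /=; pose G := good k.+1 (upd (Xs k) k True); rewrite -/G; have [g|ng] := classic G.
    move=> D; have [M [QM hM]] := g D; exists M; split=> // t lt.
    by rewrite (hM t lt) /upd; case: (pickle t =P k).
  (* If [True] fails at level [D1], approximants at level [maxn D D1] that agree so far must be
     false at code [k]; monotonicity brings them back to level [D]. *)
  have [D1 hD1] : exists D, ~ exists M, Q D M /\
      forall t, (pickle t < k.+1)%N -> (M t <-> upd (Xs k) k True (pickle t)).
    by apply: not_all_ex_not.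
  move=> D; have [M [QM hM]] := IH (maxn D D1); exists M; split.
    by apply: mono QM; lia.
  move=> t lt; rewrite /upd; case: (pickle t =P k) => [e|ne']; last by apply: hM; lia.
  split=> // Mt; case: hD1; exists M; split; first by apply: mono QM; lia.
  move=> t' lt'; rewrite /upd; case: (pickle t' =P k) => [e'|ne']; last by apply: hM; lia.
  by have -> : t' = t by [apply: (pcan_inj pickleK); rewrite e e'].
have stab i k : (i < k)%N -> Xs k i = Xs i.+1 i.
  elim: k => [//|k IH]; rewrite ltnS leq_eqVlt => /orP[/eqP->//|lt].
  by rewrite /= {1}/upd ltn_eqF //; apply: IH.
exists (fun t => Xs (pickle t).+1 (pickle t)) => s D.
pose k := (\max_(t <- s) pickle t).+1.
have [M [QM hM]] := goodX k D; exists M; split=> // t ts.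
have lt : (pickle t < k)%N by rewrite ltnS; apply: leq_bigmax_seq.
by rewrite hM // stab.
Qed.

(** For an upward closed [M], this says that the monomial ideal is generated in degrees up to
    [D]. *)
Definition generated_below n (M : 'X_{1..n} -> Prop) (D : nat) :=
  forall m, M m -> exists m', [/\ M m', (m' <= m)%MM & (mdeg m' <= D)%N].

(* A family of monomial ideals no two of which are strictly nested in bounded
   degree (e.g. all with the same Hilbert function) has uniformly bounded
   generators: a limit of counterexamples would be a finitely generated ideal
   contained in one of them. *)
Lemma uniform_generation n (C : ('X_{1..n} -> Prop) -> Prop) :
  (forall M m m', C M -> M m -> (m <= m')%MM -> M m') ->
  (forall M M' (d : nat), C M -> C M' ->
    (forall m, (mdeg m < d)%N -> M m -> M' m) ->
    (forall m, (mdeg m < d)%N -> M' m -> M m)) ->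
  exists D, forall M, C M -> generated_below M D.
Proof.
move=> up cmp; apply: NNPP => no.
pose Q D M := C M /\ ~ generated_below M D.
have [||X hX] := @compactness _ Q.
- move=> D D' M le [CM ng]; split=> // g; apply: ng => m /g[m' [? ? ?]].
  by exists m'; split=> //; lia.
- move=> D; apply: NNPP => nM; apply: no; exists D => M CM; apply: NNPP => ng.
  by apply: nM; exists M.
have upX m m' : X m -> (m <= m')%MM -> X m'.
  move=> Xm le; have [M [[CM _] e]] := hX [:: m; m'] 0%N.
  rewrite -e ?inE ?eqxx ?orbT //; apply: (up M m) => //.
  by rewrite e ?inE ?eqxx.
have [D hD] := dickson X.
have [M [[CM ng] eM]] := hX (monomials n D.+1) D.
(* [M] agrees with [X] up to degree [D], where all generators of [X] lie. *)
have XM m : X m -> M m.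
  move=> /hD[m' [Xm' le d]]; apply: up le => //.
  by rewrite eM // mem_monomials ltnS.
(* [M'] agrees with [X] up to the degree of [m], so it is contained in [M] there; the hypothesis on
   [C] turns this into equality. *)
have MX m : M m -> X m.
  move=> Mm; pose d := (mdeg m).+1.
  have [M' [[CM' _] eM']] := hX (monomials n d) 0%N.
  rewrite -eM' ?mem_monomials ?ltnSn //; apply: (cmp M' M d) => // k lt.
  by rewrite eM' ?mem_monomials // => /XM.
by apply: ng => m /MX/hD[m' [/XM ? ? ?]]; exists m'.
Qed.

(** * Initial ideals and bases of bounded parts *)

Section InitialIdeals.
Variables (K : fieldType) (n : nat).
Notation P := {mpoly K[n]}.
Implicit Types (p f : P) (m b : 'X_{1..n}) (I J : P -> Prop) (w : 'I_n -> R).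

Lemma graded_truncation I d f : is_graded_ideal I -> I f ->
  exists f', bounded_part d I f' /\
    forall m, f'@_m = if (mdeg m < d)%N then f@_m else 0.
Proof.
move=> [Iid hI] If; exists (\sum_(e < d) hcomp e f).
have e m : (\sum_(e < d) hcomp e f)@_m = if (mdeg m < d)%N then f@_m else 0.
  rewrite raddf_sum /=; case: ltnP => [lt|ge].
    rewrite (bigD1 (Ordinal lt)) //= mcoeff_hcomp eqxx big1 ?addr0 // => i ne.
    rewrite mcoeff_hcomp; case: eqP => // ei; case/eqP: ne; exact: val_inj.
  rewrite big1 // => i _; rewrite mcoeff_hcomp; case: eqP => // ei.
  by move: ge; rewrite ei leqNgt ltn_ord.
split=> //; split; first by apply: idl_sum => // i _ _; apply: hI.
by apply/msize_leP => m; rewrite e; case: ifP => //; rewrite eqxx.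
Qed.

Lemma init_bounded_lift w I d p om : is_graded_ideal I ->
  bounded_part d (init_ideal w I) p -> exists f, [/\ bounded_part d I f,
    forall m, (wdeg w m < om)%R -> f@_m = 0 & forall m, wdeg w m = om -> f@_m = p@_m].
Proof.
move=> Igr [Ip dp]; have Iid := proj1 Igr.
have /(init_idealP w p Iid) /(_ om) [f [If lf ef]] := Ip.
have [f' [Vf' e]] := graded_truncation d Igr If.
exists f'; split=> // m hm; rewrite e; first by rewrite lf ?if_same.
rewrite ef //; case: ifP => // nd; apply/esym/eqP; apply: contraFT nd.
by move/msize_leP: dp; apply.
Qed.

Lemma init_restr w I f m0 : is_ideal I -> I f ->
  (forall m, f@_m != 0 -> (wdeg w m0 <= wdeg w m)%R) ->
  init_ideal w I (mrestr (fun m => req (wdeg w m) (wdeg w m0)) f).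
Proof.
move=> Iid If hf; apply/init_idealP => // om.
have [->|ne] := Req_EM_T om (wdeg w m0).
  exists f; split=> // m hm; last by rewrite mcoeff_mrestr hm; case: reqP.
  by apply/eqP/negP => /negP/hf; lra.
exists 0; split=> [|m _|m hm]; rewrite ?mcoeff0 //; first exact: idl0.
by rewrite mcoeff_mrestr; case: reqP => // e; case: ne; rewrite -hm.
Qed.

(** The dual vector of [b] has [b] among its lightest monomials, so its initial form keeps the
    coefficient at [b]. *)
Definition weight_minimal w (V : P -> Prop) B := forall b, b \in B -> exists f,
  [/\ V f, is_dual B b f & forall m, f@_m != 0 -> (wdeg w b <= wdeg w m)%R].

Lemma weight_basis_exists w I d : is_ideal I -> exists B,
  is_basis (bounded_part d I) B /\ weight_minimal w (bounded_part d I) B.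
Proof.
move=> Iid; pose leT : rel 'X_{1..n} := fun a b => Rleb (wdeg w a) (wdeg w b).
have [|b a c|B [Bb hB]] := @bounded_part_basis K n leT d I Iid.
- by move=> a b; apply/orP; case: (Rle_dec (wdeg w a) (wdeg w b)) => h;
    [left|right]; apply/RlebP; lra.
- by move=> /RlebP h1 /RlebP h2; apply/RlebP; lra.
exists B; split=> // b /hB [f [Vf df hf]]; exists f; split=> // m /hf /RlebP; lra.
Qed.

Lemma restr_dual B b f (Q : pred 'X_{1..n}) : is_dual B b f -> Q b ->
  is_dual B b (mrestr Q f).
Proof.
move=> df Qb m mB; rewrite mcoeff_mrestr df //; case: eqP => [->|_].
  by rewrite Qb.
by rewrite if_same.
Qed.

(** Weight by weight, lift the component of [p] to an element of [I] and expand it in dual vectors.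
    Those of index heavier than the weight [om] do not reach it, and the coefficients at the other
    indices vanish: by the choice of the lift below [om], and by the hypothesis on [p] at [om]. *)
Lemma init_inj w I d B p : is_graded_ideal I ->
  is_basis (bounded_part d I) B -> weight_minimal w (bounded_part d I) B ->
  bounded_part d (init_ideal w I) p -> (forall m, m \in B -> p@_m = 0) -> p = 0.
Proof.
move=> Igr Bb wm Wp p0; have Vs := bounded_part_subspace d (proj1 Igr).
apply/mpolyP=> m; rewrite mcoeff0; set om := wdeg w m.
have [f [Vf lf ef]] := init_bounded_lift om Igr Wp.
rewrite -ef //; have [uB _ _] := Bb.
have h (i : 'I_(size B)) : exists v, (bounded_part d I v /\
    forall j : 'I_(size B), v@_(nth 0%MM B j) = (i == j)%:R) /\
    forall m, v@_m != 0 -> (wdeg w (nth 0%MM B i) <= wdeg w m)%R.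
  have [v [Vv dv hv]] := wm _ (mem_nth 0%MM (ltn_ord i)).
  exists v; split=> //; split=> // j.
  by rewrite dv ?mem_nth // nth_uniq // eq_sym.
have [v hv] := fin_all_exists h.
rewrite (expand_family Vs Bb (fun i => proj1 (hv i)) Vf) raddf_sum /= big1 // => i _.
rewrite mcoeffZ; set b := nth 0%MM B i.
have [lt|ge] := Rlt_dec om (wdeg w b).
  have [->|/(proj2 (hv i))] := eqVneq (v i)@_m 0; first by rewrite mulr0.
  by rewrite -/b -/om; lra.
suff -> : f@_b = 0 by rewrite mul0r.
have [e|ne] := Req_EM_T (wdeg w b) om; last by apply: lf; lra.
by rewrite ef // p0 // mem_nth.
Qed.

Lemma restr_bounded d f Q : (msize f <= d)%N -> (msize (mrestr Q f) <= d)%N.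
Proof.
move/msize_leP => h; apply/msize_leP => m; rewrite mcoeff_mrestr.
by case: ifP => [_ /h|]; rewrite ?eqxx.
Qed.

Lemma init_basis w I d B : is_graded_ideal I ->
  is_basis (bounded_part d I) B -> weight_minimal w (bounded_part d I) B ->
  is_basis (bounded_part d (init_ideal w I)) B.
Proof.
move=> Igr Bb wm; have [uB _ _] := Bb; split=> //.
  by move=> p Wp p0; apply: (init_inj Igr Bb wm Wp p0).
move=> b /wm [f [[If df] dual hf]].
exists (mrestr (fun m => req (wdeg w m) (wdeg w b)) f); split.
  by split; [apply: init_restr => //; exact: (proj1 Igr)|exact: restr_bounded].
by apply: restr_dual => //; apply/reqP.
Qed.

(** With [act_basis_size], this shows that passing to initial ideals and moving by [g] preserve the
    dimensions of all bounded parts. *)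
Lemma init_basis_size w I d B B' : is_graded_ideal I ->
  is_basis (bounded_part d I) B -> is_basis (bounded_part d (init_ideal w I)) B' ->
  size B = size B'.
Proof.
move=> Igr Bb Bb'; have Iid := proj1 Igr.
have [B1 [Bb1 wm]] := weight_basis_exists w d Iid.
rewrite (basis_size_eq (bounded_part_subspace d Iid) Bb Bb1).
apply: (basis_size_eq (bounded_part_subspace d (init_ideal_ideal w I))) Bb'.
exact: init_basis.
Qed.

Lemma act_basis_size g I d B B' : g \in unitmx -> is_ideal I ->
  is_basis (bounded_part d I) B -> is_basis (bounded_part d (ideal_act g I)) B' ->
  size B = size B'.
Proof.
move=> u Iid Bb Bb'; have Iid' := ideal_act_ideal u Iid.
have [v hv] := basis_family Bb; have [v' hv'] := basis_family Bb'.
apply/eqP; rewrite eqn_leq; apply/andP; split.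
  apply: (@basis_size_le K n _ (bounded_part d (ideal_act g I)) (gact g) B v) Bb' => //.
  - exact: bounded_part_subspace.
  - by move=> f Vf; apply/ideal_act_bounded => //; exists f.
  - by move=> f _ e; rewrite -(gactK u f) e linear0.
apply: (@basis_size_le K n _ (bounded_part d I) (gact (invmx g)) B' v') Bb => //.
- exact: bounded_part_subspace.
- by move=> f /(ideal_act_bounded _ _ _ u) [h Vh ->]; rewrite /= gactK.
- by move=> f _ e; rewrite -(gactVK u f) e linear0.
Qed.

Definition lead_set J m := exists f, [/\ J f, f != 0 & mlead f = m].

(** Greedy elimination for the reversed monomial order yields dual vectors led by their index, so
    leading monomials of bounded degree can be counted as a basis. *)
Lemma lead_basis J d : is_ideal J -> exists B, is_basis (bounded_part d J) B /\
  forall m, m \in B <-> lead_set J m /\ (mdeg m < d)%N.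
Proof.
move=> Jid; pose leT : rel 'X_{1..n} := fun a b => (b <= a)%O.
have [|b a c|B [Bb hB]] := @bounded_part_basis K n leT d J Jid.
- by move=> a b; rewrite /leT orbC; apply: (@le_total).
- by rewrite /leT => h1 h2; apply: le_trans h2 h1.
have Vs := bounded_part_subspace d Jid; have [uB _ _] := Bb.
have ld b f : b \in B -> is_dual B b f -> (forall m, f@_m != 0 -> leT b m) ->
    f != 0 /\ mlead f = b.
  move=> bB df hf; have fb : f@_b != 0 by rewrite df // eqxx oner_eq0.
  have f0 : f != 0 by apply: contraNneq fb => ->; rewrite mcoeff0.
  split=> //; apply/le_anti/andP; split.
    by apply: (hf (mlead f)); rewrite mleadc_eq0.
  by apply: msupp_le_mlead; rewrite mcoeff_msupp.
exists B; split=> // m; split=> [mB|[[f [Jf f0 <-]] lt]].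
  have [f [[Jf df] dual hf]] := hB m mB; have [f0 e] := ld m f mB dual hf.
  by split; [exists f|rewrite -e mlead_deg].
have Vf : bounded_part d J f by split=> //; rewrite -mlead_deg.
have h (i : 'I_(size B)) : exists v, (bounded_part d J v /\
    forall j : 'I_(size B), v@_(nth 0%MM B j) = (i == j)%:R) /\
    forall m, v@_m != 0 -> leT (nth 0%MM B i) m.
  have [v [Vv dv hv]] := hB _ (mem_nth 0%MM (ltn_ord i)).
  by exists v; split=> //; split=> // j; rewrite dv ?mem_nth // nth_uniq // eq_sym.
have [v hv] := fin_all_exists h.
have := mleadc_eq0 f; rewrite (negPf f0) => /negbT.
rewrite [in X in X@_ _](expand_family Vs Bb (fun i => proj1 (hv i)) Vf) raddf_sum /= => ne.
have [i fi] : exists i : 'I_(size B),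
    (f@_(nth 0%MM B i) *: v i)@_(mlead f) != 0.
  apply: NNPP => no; case/eqP: ne; rewrite big1 // => i _.
  by apply/eqP/negP => /negP h'; apply: no; exists i.
move: fi; rewrite mcoeffZ mulf_eq0 negb_or => /andP[h1 h2].
(* [v i] reaches [mlead f], which is thus at most its index; the index lies in the support of [f],
   which gives the other inequality. *)
have -> : mlead f = nth 0%MM B i; last exact: mem_nth.
apply/le_anti/andP; split; first exact: (proj2 (hv i)).
by apply: msupp_le_mlead; rewrite mcoeff_msupp.
Qed.

(** Division algorithm: by well-founded induction on the leading monomial, cancel it by a multiple
    of an element of [J] of degree at most [D]. *)
Lemma generated_incl J J' D : is_ideal J -> is_ideal J' ->
  generated_below (lead_set J) D ->
  (forall f, bounded_part D.+1 J f -> J' f) -> forall f, J f -> J' f.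
Proof.
move=> Jid Jid' gen incl f.
have [m] : exists m, mlead f = m by exists (mlead f).
elim/(well_founded_ind (@ltom_wf n)): m f => m IH f lf Jf.
have [->|f0] := eqVneq f 0; first exact: idl0.
have [m' [[h [Jh h0 lh]] le d]] : exists m', [/\ lead_set J m', (m' <= m)%MM & (mdeg m' <= D)%N].
  by apply: gen; exists f.
have J'h : J' h by apply: incl; split=> //; rewrite -mlead_deg // lh.
pose t := (f@_m / h@_m') *: 'X_[m - m'] * h.
have tm : t@_m = f@_m.
  rewrite /t -scalerAl mcoeffZ mcoeffXM_if lem_subr submBA // addmC addmK.
  by rewrite divfK // -lh mleadc_eq0.
have lt0 : (mlead t <= m)%O.
  rewrite /t -scalerAl; apply: le_trans (mleadZ_le _ _) _.
  apply: le_trans (mleadM_le _ _) _.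
  by rewrite mleadXm lh submK.
have Jt : J t by apply: idlM. have J't : J' t by apply: idlM.
rewrite -(subrK t f); apply: (idlD Jid') => //.
have [->|ft0] := eqVneq (f - t) 0; first exact: idl0.
apply: (IH (mlead (f - t))) => //; last exact: idlB.
rewrite lt_neqAle; apply/andP; split.
  apply/eqP=> e; move: ft0; rewrite -mleadc_eq0 e mcoeffB tm subrr eqxx //.
apply: le_trans (mleadB_le _ _) _.
by rewrite leUx lf le_refl.
Qed.

(* All initial ideals of all [g(I)] have the Hilbert function of [I]. *)
Lemma uniform_init_generation I : is_graded_ideal I -> exists D : nat,
  forall g w, g \in unitmx -> generated_below (lead_set (init_ideal w (ideal_act g I))) D.
Proof.
move=> Igr; have Iid := proj1 Igr.
pose C (M : 'X_{1..n} -> Prop) := exists g w, g \in unitmx /\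
  M = lead_set (init_ideal w (ideal_act g I)).
have [||D hD] := @uniform_generation n C.
- move=> _ m m' [g [w [u ->]]] [f [Jf f0 <-]] le.
  have X0 : 'X_[m' - mlead f] != 0 :> P.
    by apply/eqP => /(congr1 (@msupp _ _)); rewrite msuppX msupp0.
  exists ('X_[m' - mlead f] * f); split; first exact: idlM (init_ideal_ideal _ _) _ _ Jf.
    by rewrite mulf_neq0.
  by rewrite mleadM // mleadXm submK.
- move=> _ _ d [g [w [u ->]]] [g' [w' [u' ->]]] sub m lt Mm.
  have [B [Bb hB]] := lead_basis d (init_ideal_ideal w (ideal_act g I)).
  have [B' [Bb' hB']] := lead_basis d (init_ideal_ideal w' (ideal_act g' I)).
  have [B0 [Bb0 _]] := weight_basis_exists w d Iid.
  have [B1 [Bb1 _]] := weight_basis_exists w d (ideal_act_ideal u Iid).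
  have [B1' [Bb1' _]] := weight_basis_exists w d (ideal_act_ideal u' Iid).
  have e : size B = size B'.
    rewrite -(init_basis_size (ideal_act_graded u Igr) Bb1 Bb).
    rewrite -(act_basis_size u Iid Bb0 Bb1) (act_basis_size u' Iid Bb0 Bb1').
    exact: init_basis_size (ideal_act_graded u' Igr) Bb1' Bb'.
  have [uB _ _] := Bb.
  have sBB' : {subset B <= B'}.
    by move=> k /hB[Mk dk]; apply/hB'; split=> //; apply: sub.
  (* Nested sets of leading monomials of equal size coincide; this rules out strict nesting. *)
  have [|_ eB] := uniq_min_size uB sBB'; first by rewrite e.
  have /hB' : lead_set (init_ideal w' (ideal_act g' I)) m /\ (mdeg m < d)%N by [].
  by rewrite -eB => /hB[].
by exists D => g w u; apply: hD; exists g, w.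
Qed.

(* The equality pattern of initial ideals is read off from the bases of one
   bounded part, that is, from the support of its Pluecker vector. *)
Lemma init_eq_transfer I1 I2 d w w' : is_graded_ideal I1 -> is_graded_ideal I2 ->
  (forall B, is_basis (bounded_part d I1) B <-> is_basis (bounded_part d I2) B) ->
  (forall p, init_ideal w I1 p <-> init_ideal w' I1 p) ->
  forall p, bounded_part d (init_ideal w I2) p -> init_ideal w' I2 p.
Proof.
move=> gr1 gr2 eB e12 p Wp; have id1 := proj1 gr1; have id2 := proj1 gr2.
have [B [Bb1 wm1]] := weight_basis_exists w d id1.
have Bb2 : is_basis (bounded_part d I2) B by apply/eB.
have Vs1 := bounded_part_subspace d id1; have Vs2 := bounded_part_subspace d id2.
(* Supports of corresponding dual vectors are compared through [dual_exchange], since both spaces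
   have the same bases. *)
have esupp b f1 f2 m : b \in B -> bounded_part d I1 f1 -> is_dual B b f1 ->
    bounded_part d I2 f2 -> is_dual B b f2 -> f2@_m != 0 -> f1@_m != 0.
  move=> bB V1 d1 V2 d2; have [mB|mB] := boolP (m \in B); first by rewrite d1 // d2.
  move/(dual_exchange Vs2 Bb2 bB V2 d2 mB)/eB.
  by move/(dual_exchange Vs1 Bb1 bB V1 d1 mB).
have key b f : b \in B -> bounded_part d I1 f -> is_dual B b f ->
    (forall m, f@_m != 0 -> (wdeg w b <= wdeg w m)%R) ->
    forall m, f@_m != 0 -> (wdeg w' b <= wdeg w' m)%R /\
      (wdeg w m = wdeg w b <-> wdeg w' m = wdeg w' b).
  move=> bB [If df] dual hf.
  (* Otherwise the part of [f] of least [w']-weight lies in the common initial ideal and avoids [B],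
     so it is zero by [init_inj]. *)
  have hf' m : f@_m != 0 -> (wdeg w' b <= wdeg w' m)%R.
    have f0 : f != 0.
      by apply/eqP=> e; have := dual b bB; rewrite e mcoeff0 eqxx => /esym/eqP; rewrite oner_eq0.
    have [m0 [fm0 hm0]] := ex_min_weight (wdeg w') f0.
    move=> /hm0 le; suff : ~ (wdeg w' m0 < wdeg w' b)%R by lra.
    move=> lt; pose q := mrestr (fun m => req (wdeg w' m) (wdeg w' m0)) f.
    have q0 : q = 0.
      apply: (init_inj gr1 Bb1 wm1).
        by split; [apply/e12; apply: init_restr|apply: restr_bounded].
      move=> c cB; rewrite mcoeff_mrestr dual //; case: eqP => [->|_]; rewrite ?if_same //.
      by case: reqP => // e; lra.
    move: (congr1 (mcoeff m0) q0); rewrite mcoeff0 mcoeff_mrestr.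
    by case: reqP => // _ /eqP; rewrite (negPf fm0).
  pose u := mrestr (fun m => req (wdeg w m) (wdeg w b)) f.
  pose u' := mrestr (fun m => req (wdeg w' m) (wdeg w' b)) f.
  (* Both parts lie in the same initial space and are dual to [b]. *)
  have e : u = u'.
    apply: (basis_inj (bounded_part_subspace d (init_ideal_ideal w I1)) (init_basis gr1 Bb1 wm1)).
    - by split; [apply: init_restr|apply: restr_bounded].
    - by split; [apply/e12; apply: init_restr|apply: restr_bounded].
    - by move=> m mB; rewrite !(restr_dual dual) //; apply/reqP.
  move=> m fm; split; first exact: hf'.
  move/mpolyP/(_ m): e; rewrite !mcoeff_mrestr.
  case: reqP => h1; case: reqP => h2 //; try (by split); move/eqP.
    by rewrite (negPf fm).
  by rewrite eq_sym (negPf fm).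
have wm2 : weight_minimal w (bounded_part d I2) B.
  move=> b bB; have [f1 [V1 d1 h1]] := wm1 b bB.
  have [_ _ /(_ b bB) [f2 [V2 d2]]] := Bb2.
  exists f2; split=> // m /(esupp b f1 f2 m bB V1 d1 V2 d2); exact: h1.
have Wb := init_basis gr2 Bb2 wm2.
have Ws := bounded_part_subspace d (init_ideal_ideal w I2).
have [v hv] := basis_family Wb.
rewrite (expand_family Ws Wb hv Wp).
have Jid := init_ideal_ideal w' I2.
apply: idl_sum => // i _ _; apply: idlZ => //.
set b := nth 0%MM B i; have bB : b \in B by apply: mem_nth.
have [f1 [V1 d1 h1]] := wm1 b bB; have [f2 [V2 d2 h2]] := wm2 b bB.
have k2 m : f2@_m != 0 -> (wdeg w' b <= wdeg w' m)%R /\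
      (wdeg w m = wdeg w b <-> wdeg w' m = wdeg w' b).
  by move=> /(esupp b f1 f2 m bB V1 d1 V2 d2); apply: key.
have -> : v i = mrestr (fun m => req (wdeg w' m) (wdeg w' b)) f2.
  have -> : mrestr (fun m => req (wdeg w' m) (wdeg w' b)) f2 =
      mrestr (fun m => req (wdeg w m) (wdeg w b)) f2.
    apply/mpolyP => m; rewrite !mcoeff_mrestr.
    have [->|/k2[_ h]] := eqVneq f2@_m 0; first by rewrite !if_same.
    by case: reqP => a1; case: reqP => a2 //; tauto.
  apply: (basis_inj Ws Wb); first by case: (hv i).
    by case: V2 => ? ?; split; [apply: init_restr|apply: restr_bounded].
  move=> m mB; have lt : (index m B < size B)%N by rewrite index_mem.
  rewrite (restr_dual d2) //; last exact/reqP.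
  rewrite -{1}(nth_index 0%MM mB); have [_ /(_ (Ordinal lt)) /= ->] := hv i.
  congr (_%:R); congr nat_of_bool; rewrite -val_eqE /=.
  have [uB _ _] := Bb1; apply/eqP/eqP => [e|->]; last by rewrite index_uniq.
  by rewrite /b e nth_index.
by case: V2 => If2 _; apply: init_restr => // m /k2[].
Qed.

End InitialIdeals.

(** * Polynomial functions of a matrix *)

Section PolynomialFunctions.
Variables (K : fieldType) (n : nat).
Notation P := {mpoly K[n]}.
Implicit Types (f : P) (m : 'X_{1..n}) (g h : 'M[K]_n) (phi psi : 'M[K]_n -> K).

Definition polyfun phi := exists q : {mpoly K[n * n]}, forall g, phi g = q.@[mx_entries g].

Lemma polyfun_cst c : polyfun (fun=> c).
Proof. by exists c%:MP => g; rewrite mevalC. Qed.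

Lemma polyfun_entry i j : polyfun (fun g => g i j).
Proof. by exists 'X_(mxvec_index i j) => g; rewrite mevalXU /mx_entries mxvecE. Qed.

Lemma polyfunD phi psi : polyfun phi -> polyfun psi -> polyfun (fun g => phi g + psi g).
Proof. by move=> [p hp] [q hq]; exists (p + q) => g; rewrite mevalD hp hq. Qed.

Lemma polyfunM phi psi : polyfun phi -> polyfun psi -> polyfun (fun g => phi g * psi g).
Proof. by move=> [p hp] [q hq]; exists (p * q) => g; rewrite mevalM hp hq. Qed.

Lemma polyfun_ext phi psi : phi =1 psi -> polyfun phi -> polyfun psi.
Proof. by move=> e [q hq]; exists q => g; rewrite -e. Qed.

Lemma polyfun_sum (T : Type) (r : seq T) (Q : pred T) (F : T -> 'M[K]_n -> K) :
  (forall i, polyfun (F i)) -> polyfun (fun g => \sum_(i <- r | Q i) F i g).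
Proof.
move=> hF; elim: r => [|i r IH].
  by apply: polyfun_ext (polyfun_cst 0) => g; rewrite big_nil.
have [Qi|Qi] := boolP (Q i); last first.
  by apply: polyfun_ext IH => g; rewrite big_cons (negPf Qi).
by apply: polyfun_ext (polyfunD (hF i) IH) => g; rewrite big_cons Qi.
Qed.

Lemma polyfun_prod (T : Type) (r : seq T) (F : T -> 'M[K]_n -> K) :
  (forall i, polyfun (F i)) -> polyfun (fun g => \prod_(i <- r) F i g).
Proof.
move=> hF; elim: r => [|i r IH].
  by apply: polyfun_ext (polyfun_cst 1) => g; rewrite big_nil.
by apply: polyfun_ext (polyfunM (hF i) IH) => g; rewrite big_cons.
Qed.

Lemma polyfun_det k (M : 'M[K]_n -> 'M[K]_k) :
  (forall i j, polyfun (fun g => M g i j)) -> polyfun (fun g => \det (M g)).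
Proof.
move=> hM; apply: polyfun_sum => s; apply: polyfunM; first exact: polyfun_cst.
exact: polyfun_prod.
Qed.

Definition polyfamily (F : 'M[K]_n -> P) := forall m, polyfun (fun g => (F g)@_m).

Lemma polyfamily_cst f : polyfamily (fun=> f).
Proof. by move=> m; apply: polyfun_cst. Qed.

Lemma polyfamilyM F G : polyfamily F -> polyfamily G -> polyfamily (fun g => F g * G g).
Proof.
move=> hF hG m.
pose H (k : 'X_{1..n < (mdeg m).+1, (mdeg m).+1}) g := (F g)@_k.1 * (G g)@_k.2.
apply: (@polyfun_ext (fun g =>
  \sum_(k : 'X_{1..n < (mdeg m).+1, (mdeg m).+1} | m == (k.1 + k.2)%MM) H k g)).
  by move=> g; rewrite mcoeffM.
by apply: polyfun_sum => k; apply: polyfunM.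
Qed.

Lemma polyfamily_prod (T : Type) (r : seq T) (F : T -> 'M[K]_n -> P) :
  (forall i, polyfamily (F i)) -> polyfamily (fun g => \prod_(i <- r) F i g).
Proof.
move=> hF; elim: r => [|i r IH] m.
  by apply: polyfun_ext (polyfamily_cst 1 m) => g; rewrite big_nil.
by apply: polyfun_ext (polyfamilyM (hF i) IH m) => g; rewrite big_cons.
Qed.

Lemma polyfamily_gact f : polyfamily (fun g => gact g f).
Proof.
elim/mpolyind: f => [|c m f _ _ IH] k.
  by apply: polyfun_ext (polyfun_cst 0) => g; rewrite linear0 mcoeff0.
have hX i : polyfamily (fun g => gact g 'X_i).
  move=> k'; pose H j g := g i j * 'X_j@_k'.
  apply: (@polyfun_ext (fun g => \sum_j H j g)).
    by move=> g; rewrite gactXU raddf_sum /=; apply: eq_bigr => j _; rewrite mcoeffZ.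
  by apply: polyfun_sum => j; apply: polyfunM (polyfun_cst _); apply: polyfun_entry.
have hE (i : 'I_n) (e : nat) : polyfamily (fun g => gact g 'X_i ^+ e).
  elim: e => [|e IHe] k'; first exact: (polyfamily_cst 1 k').
  by apply: polyfun_ext (polyfamilyM (hX i) IHe k') => g; rewrite exprS.
have hm := polyfamily_prod (index_enum _) (fun i => hE i (m i)).
apply: polyfun_ext (polyfunD (polyfunM (polyfun_cst c) (hm k)) (IH k)) => g.
by rewrite linearP /= mcoeffD mcoeffZ gactXm.
Qed.

(** The witness may be any matrix, invertible or not; invertibility is gained at the end by
    multiplying with the determinant. *)
Definition nonvanishing phi := polyfun phi /\ exists g, phi g != 0.

Lemma nonvanishing_det : nonvanishing (fun g => \det g).
Proof.
split; last by exists 1%:M; rewrite det1 oner_eq0.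
by apply: polyfun_det => i j; apply: polyfun_entry.
Qed.

End PolynomialFunctions.

(** * Irreducibility of matrix space and generic bases *)

Section Irreducibility.
Variables (K : closedFieldType) (n : nat).
Implicit Types (phi psi : 'M[K]_n -> K).

Lemma meval_line (k : nat) (q : {mpoly K[k]}) (a d : 'I_k -> K) :
  exists p : {poly K}, forall t, q.@[fun i => a i + t * d i] = p.[t].
Proof.
elim/mpolyind: q => [|c m q _ _ [p hp]].
  by exists 0 => t; rewrite meval0 horner0.
exists (c *: \prod_(i < k) ((a i)%:P + d i *: 'X) ^+ m i + p) => t.
rewrite mevalD hp mevalZ mevalX hornerD hornerZ horner_prod; congr (_ * _ + _).
by apply: eq_bigr => i _; rewrite horner_exp !hornerE mulrC.
Qed.

(* Restricting to the line through two points where the factors do not vanish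
   reduces irreducibility of matrix space to one variable. *)
Lemma nonvanishingM phi psi : nonvanishing phi -> nonvanishing psi ->
  nonvanishing (fun g => phi g * psi g).
Proof.
move=> [pf [a fa]] [ps [b sb]]; split; first exact: polyfunM.
have line chi : polyfun chi -> exists p : {poly K}, forall t, chi (a + t *: (b - a)) = p.[t].
  move=> [q hq]; have [p hp] := meval_line q (mx_entries a) (mx_entries (b - a)).
  exists p => t; rewrite hq -hp; apply: meval_eq => i.
  by rewrite /mx_entries linearD linearZ !mxE.
have [p hp] := line _ pf; have [q hq] := line _ ps.
have p0 : p != 0.
  by apply: contraNneq fa => e; rewrite -[a]addr0 -[0](scale0r (b - a)) hp e horner0.
have q0 : q != 0.
  by apply: contraNneq sb => e; rewrite -[b](subrKC a) -[b - a]scale1r hq e horner0.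
have /closed_nonrootP[t] : p * q != 0 by rewrite mulf_neq0.
by rewrite /root hornerM -hp -hq; exists (a + t *: (b - a)).
Qed.

Lemma nonvanishing_all (T : finType) (F : T -> 'M[K]_n -> K) :
  (forall t, nonvanishing (F t)) ->
  exists phi, nonvanishing phi /\ forall g, phi g != 0 -> forall t, F t g != 0.
Proof.
move=> hF; exists (fun g => \prod_t F t g); split; last first.
  by move=> g /prodf_neq0 h t; apply: h.
elim: (index_enum T) => [|t s IH].
  split; last by exists 0; rewrite big_nil oner_eq0.
  by apply: polyfun_ext (polyfun_cst n 1) => g; rewrite big_nil.
have [pf [g hg]] := nonvanishingM (hF t) IH.
by split; [apply: polyfun_ext pf => g'|exists g]; rewrite big_cons.
Qed.

(** For each of the finitely many tuples of monomials of the right length, either its determinant is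
    not identically zero and is required not to vanish, or it is zero everywhere and the tuple is
    never a basis. *)
Lemma generic_bases (I : {mpoly K[n]} -> Prop) (d : nat) : is_ideal I ->
  exists phi, nonvanishing phi /\ forall g h, g \in unitmx -> h \in unitmx ->
    phi g != 0 -> phi h != 0 -> forall B,
    is_basis (bounded_part d (ideal_act g I)) B ->
    is_basis (bounded_part d (ideal_act h I)) B.
Proof.
move=> Iid; have [B0 [Bb0 _]] := weight_basis_exists (fun=> 0%R) d Iid.
have [v hv] := basis_family Bb0; set k := size B0.
pose D (t : k.-tuple 'X_{1..n < d}) g :=
  \det (basis_matrix v (gact g) (fun j : 'I_k => val (tnth t j))).
have hD t : exists psi, nonvanishing psi /\ forall g h, psi g != 0 -> psi h != 0 ->
    D t g != 0 -> D t h != 0.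
  have [[g0 h0]|no] := classic (exists g0, D t g0 != 0); last first.
    exists (fun=> 1); split=> [|g h _ _ Dg]; last by case: no; exists g.
    by split; [apply: polyfun_cst|exists 0; apply: oner_neq0].
  exists (D t); split; last by move=> g h _ dh _; exact: dh.
  split; last by exists g0.
  apply: polyfun_det => i j; apply: polyfun_ext (polyfamily_gact (v i) (val (tnth t j))).
  by move=> g; rewrite mxE.
have [psi hpsi] := fin_all_exists hD.
have [phi [nv hphi]] := nonvanishing_all (fun t => proj1 (hpsi t)).
exists phi; split; first exact: nv.
move=> g h ug uh /hphi pg /hphi ph B Bb.
have Bs : size B = k by rewrite -(act_basis_size ug Iid Bb0 Bb).
have [uB _ dB] := Bb.
have Bd b : b \in B -> (mdeg b < d)%N.
  move=> bB; have [f [[_ /msize_leP df] dual]] := dB b bB; apply: df.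
  by rewrite dual // eqxx oner_eq0.
have lt (i : 'I_k) : (mdeg (nth 0%MM B i) < d)%N by rewrite Bd // mem_nth // Bs.
pose t : k.-tuple 'X_{1..n < d} := [tuple BMultinom (lt i) | i < k].
have transl g' : g' \in unitmx ->
    is_basis (bounded_part d (ideal_act g' I)) B <-> D t g' != 0.
  move=> u; have := @basis_det K n (bounded_part d I) (bounded_part d (ideal_act g' I))
    (gact g') B0 v (bounded_part_subspace d Iid) Bb0.
  have -> : D t g' = \det (basis_matrix v (gact g') (fun j : 'I_k => nth 0%MM B j)).
    by congr (\det _); apply/matrixP=> i j; rewrite !mxE tnth_mktuple.
  apply=> //.
  - by move=> f Vf; apply/ideal_act_bounded => //; exists f.
  - by move=> f _ e; rewrite -(gactK u f) e linear0.
  - by move=> f /(ideal_act_bounded _ _ _ u).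
by apply/transl => //; apply: (proj2 (hpsi t) g h) => //; apply/transl.
Qed.

End Irreducibility.

(** * Supports and coordinate ideals *)

Section Supports.
Variables (K : fieldType) (n : nat).
Notation P := {mpoly K[n]}.
Implicit Types (p q f : P) (m : 'X_{1..n}) (S T U : 'X_{1..n} -> Prop).

Definition supp_in S p := forall m, p@_m != 0 -> S m.

Lemma supp_in0 S : supp_in S 0.
Proof. by move=> m; rewrite mcoeff0 eqxx. Qed.

Lemma supp_inD S p q : supp_in S p -> supp_in S q -> supp_in S (p + q).
Proof.
move=> hp hq m; rewrite mcoeffD; have [->|/hp//] := eqVneq p@_m 0.
by rewrite add0r; apply: hq.
Qed.

Lemma supp_inZ S c p : supp_in S p -> supp_in S (c *: p).
Proof. by move=> hp m; rewrite mcoeffZ mulf_eq0 negb_or => /andP[_ /hp]. Qed.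

Lemma supp_inN S p : supp_in S p -> supp_in S (- p).
Proof. by rewrite -scaleN1r; apply: supp_inZ. Qed.

Lemma supp_inB S p q : supp_in S p -> supp_in S q -> supp_in S (p - q).
Proof. by move=> hp hq; apply: supp_inD => //; apply: supp_inN. Qed.

Lemma supp_in_sum S (I : Type) (r : seq I) (Q : pred I) (F : I -> P) :
  (forall i, Q i -> supp_in S (F i)) -> supp_in S (\sum_(i <- r | Q i) F i).
Proof.
by move=> h; apply: (big_ind (supp_in S)) => // [|p q]; [apply: supp_in0|apply: supp_inD].
Qed.

Lemma supp_inX S m : S m -> supp_in S 'X_[m].
Proof. by move=> Sm k; rewrite mcoeffX; case: (m =P k) => [<-|_]; rewrite ?eqxx. Qed.

Lemma supp_in1 S : S 0%MM -> supp_in S 1.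
Proof. by rewrite -mpolyX0; apply: supp_inX. Qed.

Lemma supp_inM S T U p q : (forall a b, S a -> T b -> U (a + b)%MM) ->
  supp_in S p -> supp_in T q -> supp_in U (p * q).
Proof.
move=> h hp hq m; rewrite -mcoeff_msupp => /msuppM_le /allpairsP[[a b] /= []].
by rewrite !mcoeff_msupp => /hp Sa /hq Tb ->; apply: h.
Qed.

Lemma supp_in_ind S (Q : P -> Prop) : Q 0 ->
  (forall p q, Q p -> Q q -> Q (p + q)) -> (forall c p, Q p -> Q (c *: p)) ->
  (forall m, S m -> Q 'X_[m]) -> forall p, supp_in S p -> Q p.
Proof.
move=> Q0 QD QZ QX p hp; rewrite [p]mpolyE big_seq.
apply: (big_ind Q) => // m; rewrite mcoeff_msupp => /hp/QX; exact: QZ.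
Qed.

Lemma supp_in_det S k (M : 'M[P]_k) : S 0%MM -> (forall a b, S a -> S b -> S (a + b)%MM) ->
  (forall i j, supp_in S (M i j)) -> supp_in S (\det M).
Proof.
move=> S0 SD hM; apply: supp_in_sum => s _.
have hX : supp_in S (\prod_i M i (s i)).
  apply: (big_ind (supp_in S)) => [|p q|i _]; [exact: supp_in1|exact: supp_inM|exact: hM].
by case: odd_perm; rewrite ?expr1 ?mulN1r ?mul1r //; apply: supp_inN.
Qed.

End Supports.

Section CoordinateIdeals.
Variables (K : fieldType) (n : nat).
Notation P := {mpoly K[n]}.
Implicit Types (p q f : P) (m : 'X_{1..n}) (C : {set 'I_n}) (J : P -> Prop).

Definition involves C m := exists2 c, c \in C & m c != 0%N.

(* Membership in the ideal generated by the variables of [C]. *)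
Definition coord_ideal C p := supp_in (involves C) p.

Lemma involvesDl C a b : involves C a -> involves C (a + b)%MM.
Proof. by case=> c cC h; exists c; rewrite ?mnmDE ?addn_eq0 ?negb_and ?h. Qed.

Lemma coord_ideal_ideal C : is_ideal (coord_ideal C).
Proof.
split; [exact: supp_in0|by move=> p q; apply: supp_inD|move=> a f hf].
have h x y : involves C x -> True -> involves C (x + y)%MM.
  by move=> hx _; apply: involvesDl.
rewrite mulrC; exact (supp_inM h hf (fun _ _ => Logic.I)).
Qed.

Lemma coord_idealX C i : i \in C -> coord_ideal C 'X_i.
Proof. by move=> iC; apply: supp_inX; exists i => //; rewrite mnm1E eqxx. Qed.

Lemma coord_ideal_split C p : coord_ideal C p ->
  exists s : 'I_n -> P, p = \sum_(c in C) 'X_c * s c.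
Proof.
move: p; apply: supp_in_ind => [|_ _ [s ->] [t ->]|c _ [s ->]|m [c cC mc]].
- by exists (fun=> 0); rewrite big1 // => i _; rewrite mulr0.
- exists (fun i => s i + t i); rewrite -big_split /=.
  by apply: eq_bigr => i _; rewrite mulrDr.
- exists (fun i => c *: s i); rewrite scaler_sumr.
  by apply: eq_bigr => i _; rewrite scalerAr.
- exists (fun i => if i == c then 'X_[m - U_(c)] else 0).
  rewrite (bigD1 c) //= eqxx big1 ?addr0 => [|i /andP[_ /negPf ->]]; last by rewrite mulr0.
  by rewrite -mpolyXD addmC submK // lep1mP.
Qed.

Definition ideal_sum2 (J J' : P -> Prop) p := exists f, J f /\ J' (p - f).

Lemma ideal_sum2_ideal J J' : is_ideal J -> is_ideal J' -> is_ideal (ideal_sum2 J J').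
Proof.
move=> Jid Jid'; split.
- by exists 0; rewrite subr0; split; apply: idl0.
- move=> p q [f [Jf hf]] [h [Jh hh]]; exists (f + h); split; first exact: idlD.
  by rewrite opprD addrACA; apply: idlD.
- move=> a p [f [Jf hf]]; exists (a * f); split; first exact: idlM.
  by rewrite -mulrBr; apply: idlM.
Qed.

Lemma ideal_sum2l J J' p : is_ideal J' -> J p -> ideal_sum2 J J' p.
Proof. by move=> Jid' Jp; exists p; rewrite subrr; split=> //; apply: idl0. Qed.

Lemma ideal_sum2r J J' p : is_ideal J -> J' p -> ideal_sum2 J J' p.
Proof. by move=> Jid Jp; exists 0; rewrite subr0; split=> //; apply: idl0. Qed.

Notation modulo J C := (ideal_sum2 J (coord_ideal C)).

(** In terms of ideals: [J] together with the variables of [C] contains the [N]-th power of the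
    maximal ideal of the origin. *)
Definition cofinite J C (N : nat) := forall m, mdeg m = N -> modulo J C 'X_[m].

Lemma cofinite_homog J C N p : is_ideal J -> cofinite J C N ->
  supp_in (fun m => mdeg m = N) p -> modulo J C p.
Proof.
move=> Jid fin; have Mid := ideal_sum2_ideal Jid (coord_ideal_ideal C).
move: p; apply: supp_in_ind => //; [exact: idl0|exact: idlD|by move=> c q; apply: idlZ].
Qed.

Lemma cofinite_act J C C' N g : is_ideal J -> g \in unitmx ->
  (forall c, c \in C -> coord_ideal C' (gact g 'X_c)) ->
  cofinite J C N -> cofinite (ideal_act g J) C' N.
Proof.
move=> Jid u hC fin m dm.
have [|f [Jf hf]] := @cofinite_homog J C N (gact (invmx g) 'X_[m]) Jid fin.
  by move=> k /gactX_homog ->.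
exists (gact g f); split; first by exists f.
rewrite -[X in X - _](gactVK u) -linearB; have [s ->] := coord_ideal_split hf.
rewrite (linear_sum (gact g)) /=; apply: (idl_sum (coord_ideal_ideal C')) => c _ cC.
by rewrite rmorphM /=; apply: (idlMr (coord_ideal_ideal C')); apply: hC.
Qed.

Lemma cofinite_tperm I g C N a b : g \in unitmx -> is_ideal I -> a \in C -> b \notin C ->
  cofinite (ideal_act g I) C N ->
  exists2 g', g' \in unitmx & cofinite (ideal_act g' I) (b |: (C :\ a)) N.
Proof.
move=> u Iid aC bC fin; pose s := tperm a b.
exists (g *m perm_mx s); first by rewrite unitmx_mul u unitmx_perm.
rewrite -ideal_act_comp; apply: cofinite_act fin => //.
- exact: ideal_act_ideal.
- exact: unitmx_perm.
move=> c cC; rewrite gactXU (bigD1 (s c)) //= big1 ?addr0 => [|j ne]; last first.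
  by rewrite !mxE eq_sym (negPf ne) scale0r.
apply: (idlZ (coord_ideal_ideal _)); apply: coord_idealX.
rewrite !inE /s; case: tpermP => [_|e|]; rewrite ?eqxx //.
  by move: cC; rewrite e (negPf bC).
by move=> ca _; move/eqP: ca => ->; rewrite cC orbT.
Qed.

End CoordinateIdeals.

(** * Noether normalization *)

Notation modulo J C := (ideal_sum2 J (coord_ideal C)).

Lemma least_nat (Q : nat -> Prop) k : Q k -> exists r, Q r /\ forall r', Q r' -> (r <= r')%N.
Proof.
elim/ltn_ind: k => k IH Qk.
have [[k' [lt Qk']]|no] := classic (exists k', (k' < k)%N /\ Q k'); first exact: IH Qk'.
exists k; split=> // r' Qr'; rewrite leqNgt; apply/negP => lt; by case: no; exists r'.
Qed.

Lemma digits_inj k (N : nat) (a b : 'I_k -> nat) :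
  (forall i, (a i < N)%N) -> (forall i, (b i < N)%N) ->
  (\sum_i a i * expn N i = \sum_i b i * expn N i)%N -> forall i, a i = b i.
Proof.
elim: k a b => [|k IH] a b ha hb; first by move=> _ [].
have N0 : (0 < N)%N by apply: leq_ltn_trans (ha ord0).
have peel (c : 'I_k.+1 -> nat) : (\sum_i c i * expn N i =
    (\sum_(i < k) c (lift ord0 i) * expn N i) * N + c ord0)%N.
  rewrite big_ord_recl expn0 muln1 addnC big_distrl; congr (_ + _)%N.
  by apply: eq_bigr => i _; rewrite lift0 expnSr mulnA.
rewrite !peel => e.
have e0 : a ord0 = b ord0.
  by have := congr1 (modn^~ N) e; rewrite /= !modnMDl !modn_small.
move: e; rewrite e0 => /addIn /eqP; rewrite eqn_pmul2r // => /eqP e i.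
have [j ->|->//] := unliftP ord0 i.
by apply: (IH (fun j => a (lift ord0 j)) (fun j => b (lift ord0 j))).
Qed.

(** Kronecker substitution: setting the variable [i] to [t ^ (N ^ i)] with [N] above all exponents
    keeps distinct monomials apart, and a nonzero univariate polynomial over an algebraically closed
    field has a non-root. *)
Lemma meval_neq0 (K : closedFieldType) k (q : {mpoly K[k]}) : q != 0 ->
  exists a, q.@[a] != 0.
Proof.
move=> q0; pose N := msize q; pose wt (m : 'X_{1..k}) := (\sum_i m i * expn N i)%N.
have lt m i : m \in msupp q -> (m i < N)%N.
  move=> /msize_mdeg_lt; apply: leq_ltn_trans.
  by rewrite mdegE (bigD1 i) //= leq_addr.
pose p := \sum_(m <- msupp q) q@_m *: 'X^(wt m) : {poly K}.
have p0 : p != 0.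
  apply/eqP => /(congr1 (fun r : {poly K} => r`_(wt (mlead q)))).
  rewrite coef0 coef_sum (bigD1_seq (mlead q)) ?mlead_supp ?msupp_uniq //=.
  rewrite coefZ coefXn eqxx mulr1 big_seq_cond big1 ?addr0 => [|m /andP[mq ne]].
    by move/eqP; rewrite mleadc_eq0 (negPf q0).
  rewrite coefZ coefXn; case: (wt (mlead q) =P wt m) => [e|_]; last by rewrite mulr0.
  case/eqP: ne; apply/mnmP => i; symmetry; move: i; apply: digits_inj e => i;
    by apply: lt; rewrite ?mlead_supp.
have /closed_nonrootP[t] := p0; rewrite /root => h.
exists (fun i => t ^+ expn N i); rewrite mevalE; move: h; rewrite horner_sum.
congr (~~ (_ == _)); apply: eq_bigr => m _; rewrite hornerZ hornerXn expr_sum.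
by congr (_ * _); apply: eq_bigr => i _; rewrite -exprM mulnC.
Qed.

Lemma split_mdeg n (m : 'X_{1..n}) (N : nat) : (N <= mdeg m)%N ->
  exists a b, m = (a + b)%MM /\ mdeg a = N.
Proof.
elim: N => [_|N IH lt]; first by exists 0%MM, m; rewrite add0m mdeg0.
have [a [b [e da]]] := IH (ltnW lt).
have : b != 0%MM.
  by apply: contraTneq lt => b0; rewrite e b0 addm0 da ltnn.
rewrite -mdeg_eq0 mdegE sum_nat_eq0 negb_forall => /existsP[i /= bi].
exists (a + U_(i))%MM, (b - U_(i))%MM; rewrite mdegD da mdeg1 addn1; split=> //.
by rewrite -addmA [(U_(i) + _)%MM]addmC submK // lep1mP.
Qed.

(** * Openness of the finiteness condition *)

Section Openness.
Variables (K : fieldType) (n : nat).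
Notation P := {mpoly K[n]}.
Implicit Types (p q f : P) (m : 'X_{1..n}) (C : {set 'I_n}).

(** Only the list [L] of monomials of degree [N] free of [C] matters. At [g0] elements [v] of [I]
    map to the unit vectors on [L]; their matrix at [g] is polynomial in [g], is the identity at
    [g0], and wherever it is invertible all unit vectors on [L] are still reached. *)
Lemma cofinite_open (I : P -> Prop) C N g0 : is_graded_ideal I -> g0 \in unitmx ->
  cofinite (ideal_act g0 I) C N ->
  exists phi, nonvanishing phi /\
    forall g, g \in unitmx -> phi g != 0 -> cofinite (ideal_act g I) C N.
Proof.
move=> Igr u0 fin; have Iid := proj1 Igr.
pose off m := [forall c in C, m c == 0%N].
have offP m : ~~ off m -> involves C m.
  by rewrite negb_forall => /existsP[c]; rewrite negb_imply => /andP[? ?]; exists c.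
have offN m : off m -> ~ involves C m.
  by move/forallP=> h [c cC]; have := h c; rewrite cC /= => ->.
pose L := [seq m <- monomials n N.+1 | (mdeg m == N) && off m].
have uL : uniq L by rewrite filter_uniq ?monomials_uniq.
have memL m : (m \in L) = (mdeg m == N) && off m.
  rewrite mem_filter mem_monomials ltnS.
  by case: eqP => [->|]; rewrite ?leqnn ?andbT.
set k := size L; pose e (i : 'I_k) := nth 0%MM L i.
have eL i : e i \in L by apply: mem_nth.
have ex_v (i : 'I_k) : exists h, I h /\ forall j, (gact g0 h)@_(e j) = (i == j)%:R.
  have := eL i; rewrite memL => /andP[/eqP di oi].
  have [_ [[h [Ih ->]] hh]] := fin _ di; exists h; split=> // j.
  have := eL j; rewrite memL => /andP[_ /offN oj].
  have : ('X_[e i] - gact g0 h)@_(e j) == 0 by apply/negPn/negP => /hh.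
  rewrite mcoeffB subr_eq0 => /eqP <-; rewrite mcoeffX.
  by rewrite /e nth_uniq.
have [v hv] := fin_all_exists ex_v.
exists (fun g => \det (basis_matrix v (gact g) e)); split.
  split.
    apply: polyfun_det => i j; apply: polyfun_ext (polyfamily_gact (v i) (e j)) => g.
    by rewrite mxE.
  exists g0; have -> : basis_matrix v (gact g0) e = 1%:M.
    by apply/matrixP => i j; rewrite !mxE; case: (hv i).
  by rewrite det1 oner_eq0.
move=> g ug; rewrite -unitfE -[_ \is a _]/(basis_matrix v (gact g) e \in unitmx).
set M := basis_matrix _ _ _ => uM m dm.
have [om|/offP im] := boolP (off m); last first.
  by apply: ideal_sum2r; [apply: ideal_act_ideal|apply: supp_inX].
have mL : m \in L by rewrite memL dm eqxx.
have lt : (index m L < k)%N by rewrite index_mem.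
pose f := gact g (\sum_j (row (Ordinal lt) (invmx M)) 0 j *: v j).
(* The coefficients of [f] are controlled on [L] only; passing to the component of degree [N]
   removes the other degrees. *)
exists (hcomp N f); split.
  apply: (proj2 (ideal_act_graded ug Igr)); eexists; split; last by [].
  by apply: idl_sum => // j _ _; apply: idlZ => //; case: (hv j).
move=> m'; rewrite mcoeffB mcoeffX mcoeff_hcomp.
case: (mdeg m' =P N) => [d'|nd]; last first.
  rewrite subr0; case: (m =P m') => [e'|_]; last by rewrite eqxx.
  by case: nd; rewrite -e'.
move=> ne; apply: offP; apply: contraNN ne => om'.
have mL' : m' \in L by rewrite memL d' eqxx.
have lt' : (index m' L < k)%N by rewrite index_mem.
have -> : f@_m' = (index m L == index m' L)%:R.
  rewrite -{1}(nth_index 0%MM mL') -[nth _ _ _]/(e (Ordinal lt')) -basis_matrixE.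
  by rewrite -row_mul mulVmx // !mxE.
rewrite subr_eq0; apply/eqP; congr (_%:R); congr nat_of_bool.
apply/eqP/eqP => [->//|e'].
by rewrite -(nth_index 0%MM mL) e' nth_index.
Qed.

End Openness.

Section Congruences.
Variables (K : fieldType) (n : nat).
Notation P := {mpoly K[n]}.
Implicit Types (u v : P) (J : P -> Prop).

Lemma congr_mul J u v u' v' : is_ideal J -> J (u - v) -> J (u' - v') ->
  J (u * u' - v * v').
Proof.
move=> Jid h h'; have -> : u * u' - v * v' = (u - v) * u' + v * (u' - v').
  by rewrite mulrBl mulrBr addrA subrK.
by apply: (idlD Jid); [apply: (idlMr Jid)|apply: (idlM Jid)].
Qed.

Lemma congr_exp J u v k : is_ideal J -> J (u - v) -> J (u ^+ k - v ^+ k).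
Proof.
move=> Jid h; elim: k => [|k IH]; first by rewrite subrr; apply: idl0.
by rewrite !exprS; apply: congr_mul.
Qed.

Lemma congr_prod J (T : Type) (r : seq T) (u v : T -> P) : is_ideal J ->
  (forall i, J (u i - v i)) -> J (\prod_(i <- r) u i - \prod_(i <- r) v i).
Proof.
move=> Jid h; elim: r => [|i r IH]; first by rewrite !big_nil subrr; apply: idl0.
by rewrite !big_cons; apply: congr_mul.
Qed.

End Congruences.

Section NoetherStep.
Variables (K : closedFieldType) (n : nat).
Notation P := {mpoly K[n]}.
Implicit Types (p q f : P) (m : 'X_{1..n}) (C : {set 'I_n}) (J : P -> Prop).

Definition within C m := forall i, i \notin C -> m i = 0%N.

(* Noether normalization: a relation between the variables of [C] is made monic
   in one of them by a shear, and that variable can then be dropped. *)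
Lemma noether_step J C N f : is_graded_ideal J -> ~ J 1 -> cofinite J C N ->
  J f -> f != 0 -> supp_in (within C) f ->
  exists h c N', [/\ h \in unitmx, c \in C & cofinite (ideal_act h J) (C :\ c) N'].
Proof.
move=> Jgr J1 fin Jf f0 wf; have Jid := proj1 Jgr.
set e := mdeg (mlead f); pose F := hcomp e f.
have JF : J F by apply: (proj2 Jgr).
have F0 : F != 0.
  apply/eqP => /(congr1 (mcoeff (mlead f))) /eqP.
  by rewrite mcoeff0 mcoeff_hcomp eqxx mleadc_eq0 (negPf f0).
have hF m : F@_m != 0 -> mdeg m = e /\ within C m.
  by rewrite mcoeff_hcomp; case: (mdeg m =P e) => [-> /wf|_]; rewrite ?eqxx.
have e0 : e != 0%N.
  apply/eqP => ez; apply: J1.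
  have eF : F = (F@_0%MM)%:MP.
    apply/mpolyP => m; rewrite mcoeffC; have [<-|ne] := eqVneq 0%MM m.
      by rewrite mulr1.
    rewrite mulr0; apply/eqP/negPn/negP => /hF[]; rewrite ez => /eqP.
    by rewrite mdeg_eq0 eq_sym (negPf ne).
  have F00 : F@_0%MM != 0 by apply: contraNneq F0 => h; rewrite eF h mpolyC0.
  have -> : 1 = (F@_0%MM)^-1 *: F by rewrite {2}eF -mul_mpolyC -mpolyCM mulVf.
  exact: idlZ.
have [a Fa] := meval_neq0 F0.
(* [F] is homogeneous of positive degree in the variables of [C], so it vanishes where all of these
   are zero. *)
have [c0 [c0C ac0]] : exists c, c \in C /\ a c != 0.
  apply: NNPP => no; case/eqP: Fa; rewrite mevalE big_seq big1 // => m.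
  rewrite mcoeff_msupp => /hF[dm wm]; suff [i mi] : exists i, m i != 0%N.
    have iC : i \in C by apply: contraNT mi => /wm ->.
    rewrite (bigD1 i) //= (_ : a i = 0) ?expr0n ?(negPf mi) ?mul0r ?mulr0 //.
    by apply/eqP/negPn/negP => ai; case: no; exists i.
  apply/existsP; apply: contraNT e0; rewrite negb_exists => /forallP h.
  rewrite -dm mdegE big1 // => i _; have := h i; by rewrite negbK => /eqP.
(* Homogeneity permits rescaling the point so that its coordinate at [c0] is [1]. *)
pose b i := a i / a c0.
have Fb : F.@[b] != 0.
  have -> : F.@[b] = F.@[a] / a c0 ^+ e; last first.
    by rewrite mulf_neq0 // invr_eq0 expf_neq0.
  rewrite !mevalE mulr_suml; apply: eq_big_seq => m; rewrite mcoeff_msupp => /hF[dm _].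
  rewrite -mulrA; congr (_ * _); rewrite /b.
  under eq_bigr do rewrite expr_div_n.
  by rewrite prodf_div prodrXr -mdegE dm.
have bc0 : b c0 = 1 by rewrite /b divff.
pose C' := C :\ c0; pose be i := if i \in C' then b i else 0.
pose u : 'cV[K]_n := \col_i be i; pose d : 'rV[K]_n := delta_mx 0 c0.
(* The shear adding [b i] times the variable [c0] to each variable [i] of [C']; since [d *m u = 0],
   its inverse is [1%:M - u *m d]. *)
pose h := 1%:M + u *m d.
have du : d *m u = 0.
  apply/matrixP => i j; rewrite !mxE (bigD1 c0) //= big1 ?addr0.
    by rewrite !mxE /be !inE eqxx mulr0.
  by move=> k ne; rewrite !mxE (negPf ne) andbF mul0r.
have uh : h \in unitmx.
  have /mulmx1_unit[] // : h *m (1%:M - u *m d) = 1%:M.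
  rewrite mulmxBr mulmx1 /h mulmxDl mul1mx -mulmxA [d *m _]mulmxA du mul0mx mulmx0.
  by rewrite addr0 addrK.
have hX i : gact h 'X_i = 'X_i + be i *: 'X_c0.
  rewrite gactXU /h; under eq_bigr do rewrite !mxE big_ord1 !mxE eqxx /= scalerDl.
  rewrite big_split /=; congr (_ + _).
    rewrite (bigD1 i) //= eqxx scale1r big1 ?addr0 // => j ne.
    by rewrite eq_sym (negPf ne) scale0r.
  rewrite (bigD1 c0) //= eqxx mulr1 big1 ?addr0 // => j ne.
  by rewrite (negPf ne) mulr0 scale0r.
have C'id := coord_ideal_ideal K C'.
(* Modulo the variables of [C'] the shear restricts to the line through [b], so [F] becomes [F.@[b]]
   times the power [e] of the variable [c0]. *)
have hXm m : within C m -> coord_ideal C'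
    (gact h 'X_[m] - (\prod_i b i ^+ m i) *: 'X_c0 ^+ mdeg m).
  move=> wm; have -> : (\prod_i b i ^+ m i) *: 'X_c0 ^+ mdeg m =
      \prod_i (b i *: 'X_c0) ^+ m i :> P.
    by under [RHS]eq_bigr do rewrite exprZn; rewrite scaler_prod prodrXr -mdegE.
  rewrite gactXm; refine (@congr_prod _ _ _ _ _ (fun i => gact h 'X_i ^+ m i)
    (fun i => (b i *: 'X_c0) ^+ m i) C'id _) => i.
  have [iC|/wm ->] := boolP (i \in C); last by rewrite !expr0 subrr; apply: (idl0 C'id).
  apply: (congr_exp _ C'id); rewrite hX /be; case: ifP => [iC'|].
    by rewrite addrK; apply: coord_idealX.
  rewrite /C' !inE iC andbT => /negbFE/eqP->.
  by rewrite bc0 scale0r addr0 scale1r subrr; apply: (idl0 C'id).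
pose J' := ideal_act h J; have J'id : is_ideal J' by apply: ideal_act_ideal.
have Qid := ideal_sum2_ideal J'id C'id.
have Qe : modulo J' C' ('X_c0 ^+ e).
  have : modulo J' C' (F.@[b] *: 'X_c0 ^+ e).
    exists (gact h F); split; first by exists F.
    rewrite mevalE scaler_suml {3}[F]mpolyE (linear_sum (gact h)) -sumrB /=.
    apply: (idl_sum C'id) => m mF _; rewrite linearZ /= -scalerA -scalerBr.
    move: mF; rewrite mcoeff_msupp => /hF[dm wm].
    by rewrite -dm; apply: (idlZ C'id); rewrite -opprB; apply: (idlN C'id); apply: hXm.
  by move=> /(idlZ Qid (F.@[b])^-1); rewrite scalerA mulVf // scale1r.
have fin' : cofinite J' C N.
  apply: (cofinite_act Jid uh) fin => c cC; rewrite hX.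
  apply: (idlD (coord_ideal_ideal K C)); first exact: coord_idealX.
  by apply: (idlZ (coord_ideal_ideal K C)); apply: coord_idealX.
(* Each factor of degree [N] contributes one factor ['X_c0] modulo [J'] and the variables of [C'];
   so degree [N * e] is enough to reach the power [e]. *)
have key k : forall m, (N * k <= mdeg m)%N ->
    exists s, modulo J' C' ('X_[m] - 'X_c0 ^+ k * s).
  elim: k => [|k IH] m; first by exists 'X_[m]; rewrite expr0 mul1r subrr; apply: (idl0 Qid).
  rewrite mulnS => le; have [m1 [m2 [em dm1]]] := split_mdeg (leq_trans (leq_addr _ _) le).
  have [s Qs] : exists s, modulo J' C' ('X_[m2] - 'X_c0 ^+ k * s).
    by apply: IH; move: le; rewrite em mdegD dm1 leq_add2l.
  have [f1 [Jf1 /coord_ideal_split [t et]]] := fin' _ dm1.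
  have Q1 : modulo J' C' ('X_[m1] - 'X_c0 * t c0).
    exists f1; split=> //; rewrite addrAC et (bigD1 c0) //= addrAC subrr add0r.
    apply: (idl_sum C'id) => i _ /andP[iC ine]; apply: (idlMr C'id).
    by apply: coord_idealX; rewrite !inE ine iC.
  exists (t c0 * s); have := congr_mul Qid Q1 Qs.
  by rewrite -mpolyXD -em mulrACA -exprS.
exists h, c0, (N * e)%N; split=> // m dm.
have [|s Qs] := key e m; first by rewrite dm.
by rewrite -(subrK ('X_c0 ^+ e * s) 'X_[m]); apply: (idlD Qid) => //; apply: (idlMr Qid).
Qed.

End NoetherStep.

(** * Generic coordinates and weights *)

Section GenericNoether.
Variables (K : closedFieldType) (n : nat).
Notation P := {mpoly K[n]}.
Implicit Types (I : P -> Prop) (C : {set 'I_n}).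

Lemma cofinite_same_card I C C' N g : is_ideal I -> g \in unitmx -> #|C| = #|C'| ->
  cofinite (ideal_act g I) C N ->
  exists2 g', g' \in unitmx & cofinite (ideal_act g' I) C' N.
Proof.
move=> Iid; have [k] := ubnP #|C' :\: C|; elim: k C g => [//|k IH] C g lt u e fin.
have [sub|] := boolP (C' \subset C).
  have -> : C' = C by apply/eqP; rewrite eqEcard sub e /=.
  by exists g.
move=> /subsetPn[b bC' bC].
have /subsetPn[a aC aC'] : ~~ (C \subset C').
  apply: contraNN bC => sub; have -> // : C = C'.
  by apply/eqP; rewrite eqEcard sub -e /=.
have [g1 u1 fin1] := cofinite_tperm u Iid aC bC fin.
apply: (IH (b |: (C :\ a)) g1) => //; last first.
  by rewrite -e cardsU1 !inE (negPf bC) andbF /= [in RHS](cardsD1 a) aC.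
apply: leq_trans (lt : (#|C' :\: C| <= k)%N); apply: proper_card.
apply/properP; split.
  apply/subsetP => x; rewrite !inE negb_or negb_and negbK => /andP[/andP[xb]].
  case/orP => [/eqP-> aC''|-> -> //]; by rewrite aC'' in aC'.
by exists b; rewrite !inE ?bC' ?bC // eqxx.
Qed.

(** Take [r] minimal over all matrices and sets. Permuting coordinates reaches every set of size
    [r], [cofinite_open] makes the condition generic, and a relation among the variables of such a
    set would contradict minimality by [noether_step]. *)
Lemma generic_noether I : is_graded_ideal I -> ~ I 1 ->
  exists r phi, [/\ (r <= n)%N, nonvanishing phi &
    forall g, g \in unitmx -> phi g != 0 -> forall C, #|C| = r ->
      (exists N, cofinite (ideal_act g I) C N) /\
      (forall f, ideal_act g I f -> supp_in (within C) f -> f = 0)].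
Proof.
move=> Igr I1; have Iid := proj1 Igr.
pose Q r := exists g C N, [/\ g \in unitmx, #|C| = r & cofinite (ideal_act g I) C N].
have Qn : Q n.
  exists 1%:M, setT, 1%N; split; [exact: unitmx1|by rewrite cardsT card_ord|].
  move=> m dm; apply: ideal_sum2r; first exact: (ideal_act_ideal (unitmx1 _ _) Iid).
  apply: supp_inX; have /mdeg1P[i /eqP->] : mdeg m == 1%N by rewrite dm.
  by exists i; rewrite ?inE // mnm1E eqxx.
have [r [[g0 [C0 [N [u0 c0 fin0]]]] min]] := least_nat Qn.
have rn := min _ Qn.
have ex_phi C : exists phi, nonvanishing phi /\ forall g, g \in unitmx -> phi g != 0 ->
    #|C| = r -> cofinite (ideal_act g I) C N.
  have [cC|ne] := eqVneq #|C| r; last first.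
    exists (fun=> 1); split; last by move=> g _ _ e; rewrite e eqxx in ne.
    by split; [apply: polyfun_cst|exists 0; apply: oner_neq0].
  have [|g1 u1 fin1] := cofinite_same_card Iid u0 _ fin0 (C' := C); first by rewrite c0.
  have [phi [nv h]] := cofinite_open Igr u1 fin1.
  by exists phi; split; [exact: nv|move=> g u p _; apply: h].
have [phiC hphi] := fin_all_exists ex_phi.
have [phi [nv h]] := nonvanishing_all (fun C => proj1 (hphi C)).
exists r, phi; split; [exact: rn|exact: nv|].
move=> g u pg C cC; have fin := proj2 (hphi C) g u (h g pg C) cC.
split; first by exists N.
move=> f Jf wf; apply/eqP/negPn/negP => f0.
have [|h' [c [N' [u' cinC fin']]]] := noether_step (ideal_act_graded u Igr) _ fin Jf f0 wf.
  by move=> /(ideal_actE _ _ u); rewrite rmorph1.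
have : (r <= #|C :\ c|)%N.
  apply: min; exists (g *m h'), (C :\ c), N'; split; [|by []|].
    by rewrite unitmx_mul u u'.
  by rewrite -ideal_act_comp.
by rewrite -cC (cardsD1 c C) cinC ltnn.
Qed.

End GenericNoether.

(** * Weights, module generation and determinants *)

Section Monomials.
Variables (K : fieldType) (n : nat).
Notation P := {mpoly K[n]}.
Implicit Types (p q f : P) (m : 'X_{1..n}) (C : {set 'I_n}) (J : P -> Prop) (w v : 'I_n -> R).

Lemma wdeg_ge0 w m : (forall i, (0 <= w i)%R) -> (0 <= wdeg w m)%R.
Proof.
move=> h; apply: (big_ind (fun x => (0 <= x)%R)) => [|x y|i _]; [lra|move=> *; lra|].
by apply: Rmult_le_pos => //; apply: pos_INR.
Qed.

Lemma wdeg_gt0 w m i : (forall i, (0 <= w i)%R) -> m i != 0%N -> (0 < w i)%R ->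
  (0 < wdeg w m)%R.
Proof.
move=> h mi wi; rewrite /wdeg (bigD1 i) //=.
have h1 : (0 < w i * INR (m i))%R.
  by apply: Rmult_lt_0_compat => //; apply: lt_0_INR; apply/ssrnat.ltP; rewrite lt0n.
have h2 : (0 <= \big[Rplus/0%R]_(j < n | j != i) (w j * INR (m j)))%R.
  apply: (big_ind (fun x => (0 <= x)%R)) => [|x y|j _]; [lra|move=> *; lra|].
  by apply: Rmult_le_pos => //; apply: pos_INR.
exact: Rplus_lt_le_0_compat.
Qed.

Lemma wdeg_eq0 w m : (forall i, m i != 0%N -> w i = 0%R) -> wdeg w m = 0%R.
Proof.
move=> h; rewrite /wdeg big1 // => i _; have [->|/h->] := eqVneq (m i) 0%N.
  by rewrite /= Rmult_0_r.
by rewrite Rmult_0_l.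
Qed.

Lemma wdeg_affine w v c m : wdeg (fun i => w i + c * v i)%R m = (wdeg w m + c * wdeg v m)%R.
Proof.
rewrite /wdeg; have h (s : seq 'I_n) (F G : 'I_n -> R) :
    \big[Rplus/0%R]_(i <- s) (F i + c * G i)%R =
    (\big[Rplus/0%R]_(i <- s) F i + c * \big[Rplus/0%R]_(i <- s) G i)%R.
  elim: s => [|i s IH]; first by rewrite !big_nil; ring.
  by rewrite !big_cons IH; ring.
rewrite -h; apply: eq_bigr => i _; ring.
Qed.

Lemma wdeg_cst c m : wdeg (fun=> c) m = (c * INR (mdeg m))%R.
Proof.
rewrite /wdeg mdegE; have h (s : seq 'I_n) :
    \big[Rplus/0%R]_(i <- s) (c * INR (m i))%R = (c * INR (\sum_(i <- s) m i))%R.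
  elim: s => [|i s IH]; first by rewrite !big_nil /=; ring.
  by rewrite !big_cons IH plus_INR; ring.
exact: h.
Qed.

(** A constant shift of the weight does not affect comparisons between monomials of equal degree; so
    the minimal coordinate may be taken to be zero. *)
Lemma wdeg_shift w c m : wdeg w m = (wdeg (fun i => w i - c) m + c * INR (mdeg m))%R.
Proof.
rewrite -wdeg_cst /wdeg -big_split /=; apply: eq_bigr => i _; lra.
Qed.

Lemma wdegMn w m k : wdeg w (m *+ k)%MM = (INR k * wdeg w m)%R.
Proof.
elim: k => [|k IH]; last by rewrite mulmS wdegD IH S_INR; lra.
by rewrite mulm0n wdeg_eq0 /= ?Rmult_0_l // => i; rewrite mnm0E.
Qed.

(* Reducing a power of a minimal-weight variable modulo heavier variables
   exhibits that power as an initial form. *)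
Lemma cofinite_init_monomial J C N w i0 : is_graded_ideal J -> cofinite J C N ->
  i0 \notin C -> (forall j, (w i0 <= w j)%R) -> (forall c, c \in C -> (w i0 < w c)%R) ->
  exists p, init_ideal w J p /\ is_monomial p.
Proof.
move=> Jgr fin i0C wmin wC; set m0 := (U_(i0) *+ N)%MM.
have dm0 : mdeg m0 = N by rewrite mdegMn mdeg1 mul1n.
have [f [Jf hf]] := fin _ dm0; pose F := hcomp N f.
have JF : J F by apply: (proj2 Jgr).
pose v i := (w i - w i0)%R.
have v0 i : (0 <= v i)%R by have := wmin i; rewrite /v; lra.
have vm0 : wdeg v m0 = 0%R.
  apply: wdeg_eq0 => i; rewrite mulmnE mnm1E; case: (i0 =P i) => [<- _|]; rewrite ?mul0n //.
  by rewrite /v; lra.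
have nm0 : ~ involves C m0.
  move=> [c cC]; rewrite mulmnE mnm1E; case: (i0 =P c) => [e|]; rewrite ?mul0n //.
  by rewrite e cC in i0C.
have shift m : mdeg m = N -> wdeg w m = (wdeg v m + w i0 * INR N)%R.
  by move=> dm; rewrite (wdeg_shift w (w i0)) dm.
have hF m : F@_m != 0 -> mdeg m = N /\ (m = m0 \/ involves C m).
  rewrite mcoeff_hcomp; case: (mdeg m =P N) => [dm fm|]; rewrite ?eqxx //; split=> //.
  have [->|ne] := eqVneq m m0; [by left|right; apply: hf].
  by rewrite mcoeffB mcoeffX [m0 == m]eq_sym (negPf ne) sub0r oppr_eq0.
exists (mrestr (fun m => req (wdeg w m) (wdeg w m0)) F); split.
  apply: init_restr => //; first exact: (proj1 Jgr).
  by move=> m /hF[dm _]; rewrite !shift // vm0; have := wdeg_ge0 m v0; lra.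
exists 1, m0; split; first exact: oner_neq0.
apply/mpolyP => m; rewrite scale1r mcoeff_mrestr mcoeffX.
have [<-|ne] := eqVneq m0 m.
  case: reqP => // _; rewrite mcoeff_hcomp dm0 eqxx; apply/eqP; rewrite eq_sym -subr_eq0.
  apply/negPn/negP => h; apply: nm0; apply: hf.
  by rewrite mcoeffB mcoeffX eqxx.
case: reqP => // e; apply/eqP/negPn/negP => /hF[dm [em|[c cC mc]]].
  by rewrite em eqxx in ne.
have := wdeg_gt0 v0 mc; have := wC c cC; move: e; rewrite !shift // vm0 /v; lra.
Qed.

(** Induction on the degree: above degree [N], a factor of degree [N] is congruent modulo [J] to a
    form of the same degree all of whose monomials involve [C]; a variable of [C] can be pulled out,
    and the cofactor has smaller degree. *)
Lemma module_generation J C N p : is_graded_ideal J -> cofinite J C N ->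
  exists r : 'X_{1..n < N.+1} -> P, (forall e, supp_in (within C) (r e)) /\
    J (p - \sum_e r e * 'X_[e]).
Proof.
move=> Jgr fin; have Jid := proj1 Jgr.
pose Q p := exists r : 'X_{1..n < N.+1} -> P, (forall e, supp_in (within C) (r e)) /\
    J (p - \sum_e r e * 'X_[e]).
have QJ q : J q -> Q q.
  move=> Jq; exists (fun=> 0); split=> [e|]; first exact: supp_in0.
  by rewrite big1 ?subr0 // => e _; rewrite mul0r.
have QD q1 q2 : Q q1 -> Q q2 -> Q (q1 + q2).
  move=> [r1 [h1 e1]] [r2 [h2 e2]]; exists (fun e => r1 e + r2 e).
  split=> [e|]; first exact: supp_inD.
  under eq_bigr do rewrite mulrDl.
  by rewrite big_split opprD addrACA; apply: (idlD Jid).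
have QM a q : supp_in (within C) a -> Q q -> Q (a * q).
  move=> ha [r [h e]]; exists (fun e => a * r e); split=> [e'|].
    apply: (@supp_inM _ _ (within C) (within C)) => // x y hx hy i iC.
    by rewrite mnmDE hx ?hy.
  under eq_bigr do rewrite -mulrA.
  by rewrite -mulr_sumr -mulrBr; apply: (idlM Jid).
have QZ c q : Q q -> Q (c *: q).
  rewrite -mul_mpolyC; apply: QM => m; rewrite mcoeffC; case: (m =P 0%MM) => [-> _ i _|_].
    by rewrite mnm0E.
  by rewrite mulr0 eqxx.
have Qm d : forall m, mdeg m = d -> Q 'X_[m].
  elim/ltn_ind: d => d IH m dm.
  have [lt|ge] := ltnP d N.+1.
    have lt' : (mdeg m < N.+1)%N by rewrite dm.
    exists (fun e => (e == BMultinom lt')%:R); split=> [e|].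
      by case: eqP => _; [apply: supp_in1 => i _; rewrite mnm0E|apply: supp_in0].
    rewrite (bigD1 (BMultinom lt')) //= eqxx mul1r big1 ?addr0 => [|e ne].
      by rewrite subrr; apply: (idl0 Jid).
    by rewrite (negPf ne) mul0r.
  have [m1 [m2 [em dm1]]] := split_mdeg (leq_trans (ltnW ge) (eq_leq (esym dm))).
  have [f [Jf hf]] := fin _ dm1; pose F := hcomp N f.
  have JF : J F by apply: (proj2 Jgr).
  rewrite em mpolyXD -(subrK F 'X_[m1]) mulrDl; apply: (QD); last first.
    by apply: QJ; apply: (idlMr Jid).
  have : supp_in (fun k => mdeg k = N /\ involves C k) ('X_[m1] - F).
    move=> k; rewrite mcoeffB mcoeffX mcoeff_hcomp; case: (mdeg k =P N) => [dk|nd].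
      by rewrite -mcoeffX -mcoeffB => /hf.
    rewrite subr0; case: (m1 =P k) => [e|_]; last by rewrite eqxx.
    by case: nd; rewrite -e.
  move: ('X_[m1] - F); apply: supp_in_ind => [|a b Qa Qb|c a Qa|k [dk [c cC kc]]].
  - by rewrite mul0r; apply: QJ; apply: (idl0 Jid).
  - by rewrite mulrDl; apply: QD.
  - by rewrite -scalerAl; apply: QZ.
  - have le : (U_(c) <= k)%MM by rewrite lep1mP.
    rewrite -(submK le) mpolyXD [_ * 'X_c]mulrC -mulrA -mpolyXD; apply: QM.
      apply: supp_inX => i iC; rewrite mnm1E; case: (c =P i) => // e; by rewrite -e cC in iC.
    apply: (IH (mdeg (k - U_(c) + m2)%MM)) => //.
    rewrite -dm em !mdegD dm1 ltn_add2r -dk -{2}(submK le) mdegD mdeg1; lia.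
rewrite -/(Q p) [p]mpolyE; apply: (big_ind Q) => // [|m _]; last by apply: QZ; apply: Qm.
by apply: QJ; apply: (idl0 Jid).
Qed.

Lemma prod_weight w om (T : eqType) (s : seq T) (p : T -> P) :
  (forall i, supp_in (fun m => (om <= wdeg w m)%R) (p i)) ->
  supp_in (fun m => (INR (size s) * om <= wdeg w m)%R) (\prod_(i <- s) p i) /\
  forall i, i \in s -> supp_in (fun m => (om < wdeg w m)%R) (p i) ->
    supp_in (fun m => (INR (size s) * om < wdeg w m)%R) (\prod_(i <- s) p i).
Proof.
move=> h; elim: s => [|a s [IH1 IH2]].
  split=> //; rewrite big_nil; apply: supp_in1; rewrite wdeg_eq0 /= => [|i]; first by lra.
  by rewrite mnm0E.
rewrite big_cons (_ : INR (size (a :: s)) = INR (size s) + 1)%R; last by rewrite -S_INR.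
split.
  apply: (supp_inM _ (h a) IH1) => x y; rewrite wdegD; lra.
move=> i; rewrite in_cons => /orP[/eqP->|si] hi.
  apply: (supp_inM _ hi IH1) => x y; rewrite wdegD; lra.
apply: (supp_inM _ (h a) (IH2 i si hi)) => x y; rewrite wdegD; lra.
Qed.

Lemma diag_weight w om (T : eqType) (s : seq T) E (a : T -> P) :
  supp_in (fun m => (om <= wdeg w m)%R) E ->
  (forall i, supp_in (fun m => (om < wdeg w m)%R) (a i)) ->
  supp_in (fun m => (INR (size s) * om < wdeg w m)%R)
    (\prod_(i <- s) (E - a i) - E ^+ size s).
Proof.
move=> hE ha; have hEa i : supp_in (fun m => (om <= wdeg w m)%R) (E - a i).
  by apply: supp_inB => // m /ha; lra.
elim: s => [|i s IH]; first by rewrite big_nil subrr; apply: supp_in0.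
rewrite big_cons (_ : INR (size (i :: s)) = INR (size s) + 1)%R; last by rewrite -S_INR.
have [hX _] := @prod_weight w om T s _ hEa; set X := \prod_(j <- s) _ in IH hX *.
have -> : (E - a i) * X - E ^+ size (i :: s) = E * (X - E ^+ size s) - a i * X.
  by rewrite mulrBr -exprS mulrBl addrAC.
apply: supp_inB; [apply: (supp_inM _ hE IH)|apply: (supp_inM _ (ha i) hX)] => x y;
  rewrite wdegD; lra.
Qed.

(** The identity permutation contributes [E ^+ k] plus heavier terms; any other permutation uses an
    off-diagonal entry, which is heavier than [om]. *)
Lemma det_weight w om k E (A : 'M[P]_k) :
  supp_in (fun m => (om <= wdeg w m)%R) E ->
  (forall i j, supp_in (fun m => (om < wdeg w m)%R) (A i j)) ->
  supp_in (fun m => (INR k * om < wdeg w m)%R) (\det (E%:M - A) - E ^+ k).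
Proof.
move=> hE hA; rewrite /determinant (bigD1 (1%g : 'S_k)) //= odd_perm1 expr0 mul1r addrAC.
have sk : size (index_enum 'I_k) = k by rewrite [index_enum _]unlock -enumT size_enum_ord.
apply: supp_inD.
  rewrite (eq_bigr (fun i => E - A i i)) => [|i _]; last by rewrite !mxE perm1 eqxx.
  have := @diag_weight w om _ (index_enum 'I_k) E (fun i => A i i) hE (fun i => hA i i).
  by rewrite sk.
apply: supp_in_sum => s s1.
have hX : supp_in (fun m => (INR k * om < wdeg w m)%R) (\prod_i (E%:M - A) i (s i)).
  have [i si] : exists i, s i != i.
    apply/existsP; apply: contraNT s1; rewrite negb_exists => /forallP h.
    by apply/eqP/permP => i; have := h i; rewrite negbK perm1 => /eqP.
  have hM i' : supp_in (fun m => (om <= wdeg w m)%R) ((E%:M - A) i' (s i')).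
    rewrite !mxE; apply: supp_inB => [|m /hA]; last by lra.
    by case: eqP => _; [exact: hE|rewrite mulr0n; apply: supp_in0].
  have [_] := @prod_weight w om _ (index_enum 'I_k) _ hM; rewrite sk => /(_ i); apply.
    by rewrite mem_index_enum.
  by rewrite !mxE eq_sym (negPf si) mulr0n sub0r; apply: supp_inN.
by case: odd_perm; rewrite ?expr1 ?mulN1r ?mul1r //; apply: supp_inN.
Qed.

End Monomials.

(** * Monomial-free initial ideals *)

Section NoMonomial.
Variables (K : fieldType) (n : nat).
Notation P := {mpoly K[n]}.
Implicit Types (p q f : P) (m : 'X_{1..n}) (C B : {set 'I_n}) (J : P -> Prop) (w v : 'I_n -> R).

Lemma withinD C a b : within C a -> within C b -> within C (a + b)%MM.
Proof. by move=> ha hb i iC; rewrite mnmDE ha ?hb. Qed.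

Lemma mnm_part C m : exists a b, [/\ m = (a + b)%MM, within C a &
  forall i, i \in C -> b i = 0%N].
Proof.
exists [multinom if i \in C then m i else 0%N | i < n],
  [multinom if i \in C then 0%N else m i | i < n]; split.
- by apply/mnmP => i; rewrite mnmDE !mnmE; case: ifP; rewrite ?addn0.
- by move=> i /negPf iC; rewrite mnmE iC.
- by move=> i iC; rewrite mnmE iC.
Qed.

Lemma weight_ideal w om : (forall i, (0 <= w i)%R) ->
  is_ideal (supp_in (fun m => (om < wdeg w m)%R) : P -> Prop).
Proof.
move=> w0; split; [exact: supp_in0|by move=> p q; apply: supp_inD|move=> a p hp].
have ha : supp_in (fun m => (0 <= wdeg w m)%R) a by move=> m _; apply: wdeg_ge0.
by apply: (supp_inM _ ha hp) => x y; rewrite wdegD; lra.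
Qed.

(** The weight lives on [C] only, so it is carried entirely by the [C]-part of each monomial; the
    remaining part is rewritten by [module_generation] without losing weight. *)
Lemma weighted_generation J C N w om p : is_graded_ideal J -> cofinite J C N ->
  (forall i, (0 <= w i)%R) -> (forall i, i \notin C -> w i = 0%R) ->
  supp_in (fun m => (om < wdeg w m)%R) p ->
  exists r : 'X_{1..n < N.+1} -> P,
    (forall e, supp_in (fun m => within C m /\ (om < wdeg w m)%R) (r e)) /\
    J (p - \sum_e r e * 'X_[e]).
Proof.
move=> Jgr fin w0 wC; have Jid := proj1 Jgr.
move: p; apply: supp_in_ind => [|p q [r1 [h1 e1]] [r2 [h2 e2]]|c p [r [h e]]|m hm].
- exists (fun=> 0); split=> [e|]; first exact: supp_in0.
  by rewrite big1 ?subr0 => [|e _]; rewrite ?mul0r //; apply: (idl0 Jid).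
- exists (fun e => r1 e + r2 e); split=> [e|]; first exact: supp_inD.
  under eq_bigr do rewrite mulrDl.
  by rewrite big_split opprD addrACA; apply: (idlD Jid).
- exists (fun e => c *: r e); split=> [e'|]; first exact: supp_inZ.
  under eq_bigr do rewrite -scalerAl.
  by rewrite -scaler_sumr -scalerBr; apply: (idlZ Jid).
have [a [b [em wa b0]]] := mnm_part C m.
have [r [h e]] := module_generation 'X_[b] Jgr fin.
have wb : wdeg w b = 0%R.
  by apply: wdeg_eq0 => i bi; apply: wC; apply: contraNN bi => /b0 ->.
exists (fun e => 'X_[a] * r e); split=> [e'|].
  have ha : supp_in (fun k => within C k /\ (om < wdeg w k)%R) ('X_[a] : P).
    by apply: supp_inX; split=> //; move: hm; rewrite em wdegD wb; lra.
  apply: (supp_inM _ ha (h e')) => x y [wx ox] wy; split; first exact: withinD.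
  by have := wdeg_ge0 y w0; rewrite wdegD; lra.
under eq_bigr do rewrite -mulrA.
by rewrite em mpolyXD -mulr_sumr -mulrBr; apply: (idlM Jid).
Qed.

(* Determinant trick: multiplication by 'X_[e0] on the finite K[x_C]-module S/J
   has a characteristic polynomial whose leading monomial cannot cancel, against
   the algebraic independence of the variables of [C]. *)
Lemma no_relation J C N w e0 g : is_graded_ideal J -> cofinite J C N ->
  (forall f, J f -> supp_in (within C) f -> f = 0) ->
  (forall i, (0 <= w i)%R) -> (forall i, i \notin C -> w i = 0%R) ->
  within C e0 -> J ('X_[e0] - g) ->
  supp_in (fun m => (wdeg w e0 < wdeg w m)%R) g -> False.
Proof.
move=> Jgr fin indep w0 wC we Jg hg; have Jid := proj1 Jgr.
set om := wdeg w e0 in hg; pose T := 'X_{1..n < N.+1}.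
have ex_r (e : T) : exists r : T -> P,
    (forall e', supp_in (fun m => within C m /\ (om < wdeg w m)%R) (r e')) /\
    J ('X_[e0] * 'X_[e] - \sum_e' r e' * 'X_[e']).
  have hge : supp_in (fun m => (om < wdeg w m)%R) (g * 'X_[e]).
    by rewrite mulrC; apply: idlM hg; apply: weight_ideal.
  have [r [h1 h2]] := weighted_generation Jgr fin w0 wC hge.
  exists r; split=> //; rewrite -(subrK (g * 'X_[e]) ('X_[e0] * 'X_[e])) -addrA -mulrBl.
  by apply: (idlD Jid) => //; apply: (idlMr Jid).
have [r hr] := fin_all_exists ex_r; pose k := #|{: T}|.
pose ev (i : 'I_k) : T := enum_val i.
pose A : 'M[P]_k := \matrix_(i, j) r (ev i) (ev j).
pose y : 'cV[P]_k := \col_i 'X_[ev i].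
pose M := 'X_[e0]%:M - A; pose D := \det M.
have Jz i : J ((M *m y) i 0).
  have := proj2 (hr (ev i)); congr J.
  rewrite mulmxBl mul_scalar_mx !mxE; congr (_ - _).
  rewrite (reindex_onto ev enum_rank) => [|e _]; last exact: enum_rankK.
  by apply: eq_big => [j|j _]; rewrite ?mxE // /ev enum_valK eqxx.
(* Cramer's rule puts [D] times every entry of [y] in [J]; the entry for the monomial [1] gives [D]
   itself. *)
have JD : J D.
  have -> : D = (D%:M *m y) (enum_rank (@bm0 n N)) 0.
    by rewrite mul_scalar_mx !mxE /ev enum_rankK mpolyX0 mulr1.
  rewrite -mul_adj_mx -mulmxA mxE.
  by apply: idl_sum => // j _ _; apply: (idlM Jid).
have wD : supp_in (within C) D.
  apply: supp_in_det => [i _|a b|i j]; [by rewrite mnm0E|exact: withinD|].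
  rewrite !mxE; apply: supp_inB => [|m].
    by case: eqP => _; [apply: supp_inX|rewrite mulr0n; apply: supp_in0].
  by case/(proj1 (hr (ev i)) (ev j)).
have D0 : D = 0 by apply: indep.
have hE : supp_in (fun m => (om <= wdeg w m)%R) ('X_[e0] : P).
  by apply: supp_inX; rewrite /om; lra.
have hA i j : supp_in (fun m => (om < wdeg w m)%R) (A i j).
  by rewrite mxE => m /(proj1 (hr (ev i)) (ev j)) [].
(* With [D = 0], the monomial [e0 *+ k] would have to weigh more than [INR k * om], which is exactly
   its weight. *)
have := @det_weight _ _ w om k 'X_[e0] A hE hA (e0 *+ k)%MM.
rewrite -/M -/D D0 sub0r mcoeffN mcoeffXn eqxx oppr_eq0 => /(_ (oner_neq0 _)).
by rewrite wdegMn /om; lra.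
Qed.

Lemma small_perturbation (T : eqType) (s : seq T) (d : T -> R) (be : R) : (0 <= be)%R ->
  (forall x, x \in s -> (0 < d x)%R) ->
  exists eps, (0 < eps)%R /\ forall x, x \in s -> (eps * be < d x)%R.
Proof.
move=> be0; elim: s => [|a s IH] h; first by exists 1%R; split=> //; lra.
have [x xs|eps [eps0 he]] := IH; first by apply: h; rewrite in_cons xs orbT.
have da := h a (mem_head _ _).
pose eta := (d a / (1 + be))%R.
have eta0 : (0 < eta)%R by apply: Rdiv_lt_0_compat; lra.
have etaE : (eta * (1 + be) = d a)%R by rewrite /eta; field; lra.
exists (Rmin eps eta); split; first exact: Rmin_pos.
have m1 := Rmin_l eps eta; have m2 := Rmin_r eps eta.
have m0 : (0 < Rmin eps eta)%R by apply: Rmin_pos.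
move=> x; rewrite in_cons => /orP[/eqP->|/he hx]; nra.
Qed.

(** A monomial [m] in the initial ideal lifts to some [F] with [m] strictly lightest. The part of
    [m] outside [B] weighs nothing after the shift by [mu] and can be traded for a power of the
    variable [a], giving a monomial in the variables of [a |: B] congruent to heavier terms;
    [no_relation] excludes this. *)
Lemma no_init_monomial J B a w mu : is_graded_ideal J -> a \notin B ->
  (forall i, i \notin B -> exists N, cofinite J (i |: B) N) ->
  (forall f, J f -> supp_in (within (a |: B)) f -> f = 0) ->
  (forall i, i \notin B -> w i = mu) -> (forall i, (mu <= w i)%R) ->
  forall p, init_ideal w J p -> ~ is_monomial p.
Proof.
move=> Jgr aB fin indep wB wmin p Ip [c [m [c0 ep]]]; have Jid := proj1 Jgr.
have /(init_idealP _ _ Jid)/(_ (wdeg w m)) [f [Jf lf ef]] := Ip.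
pose F := hcomp (mdeg m) f; have JF : J F by apply: (proj2 Jgr).
have Fm : F@_m = c by rewrite mcoeff_hcomp eqxx ef // ep mcoeffZ mcoeffX eqxx mulr1.
pose v i := (w i - mu)%R; pose ind i := (if i \in B then 1 else 0)%R.
have v0 i : (0 <= v i)%R by have := wmin i; rewrite /v; lra.
have ind0 i : (0 <= ind i)%R by rewrite /ind; case: ifP => _; lra.
have hF m' : F@_m' != 0 -> m' != m -> (wdeg v m < wdeg v m')%R.
  rewrite mcoeff_hcomp; case: (mdeg m' =P mdeg m) => [dm fm ne|]; rewrite ?eqxx //.
  suff : (wdeg w m < wdeg w m')%R by rewrite !(wdeg_shift w mu) dm /v; lra.
  have [lt|nlt] := Rlt_dec (wdeg w m') (wdeg w m); first by rewrite lf ?eqxx in fm.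
  have [e|] := Req_EM_T (wdeg w m') (wdeg w m); last by lra.
  by move: fm; rewrite ef // ep mcoeffZ mcoeffX eq_sym [m == m']eq_sym (negPf ne) mulr0 eqxx.
(* [v] may vanish on part of [B]; a small multiple of [ind] makes it positive on all of [B] while
   [m] stays strictly lightest in [F]. *)
have [eps [eps0 heps]] : exists eps, (0 < eps)%R /\
    forall m', m' \in [seq m' <- msupp F | m' != m] ->
    (eps * wdeg ind m < wdeg v m' - wdeg v m)%R.
  apply: (small_perturbation (d := fun m' => (wdeg v m' - wdeg v m)%R)).
    exact: wdeg_ge0.
  move=> m'; rewrite mem_filter mcoeff_msupp => /andP[ne fm].
  by have := hF m' fm ne; lra.
pose u i := (v i + eps * ind i)%R.
have u0 i : (0 <= u i)%R by have := v0 i; have := ind0 i; rewrite /u; nra.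
have uB i : i \in B -> (0 < u i)%R by move=> iB; have := v0 i; rewrite /u /ind iB; lra.
have unB i : i \notin B -> u i = 0%R.
  by move=> iB; rewrite /u /v /ind (negPf iB) wB //; lra.
have hFu m' : F@_m' != 0 -> m' != m -> (wdeg u m < wdeg u m')%R.
  move=> fm ne; have := heps m'; rewrite mem_filter ne mcoeff_msupp fm => /(_ isT).
  rewrite /u !wdeg_affine; have := wdeg_ge0 m' ind0; nra.
set om := wdeg u m in hFu; pose G : P -> Prop := supp_in (fun k => (om < wdeg u k)%R).
have Gid : is_ideal G by apply: weight_ideal.
have Hid := ideal_sum2_ideal Jid Gid; have Rid := ideal_sum2_ideal Jid (coord_ideal_ideal K B).
have Hm : ideal_sum2 J G 'X_[m].
  exists (c^-1 *: F); split; first exact: idlZ.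
  move=> k; rewrite mcoeffB mcoeffX mcoeffZ; have [<-|ne] := eqVneq m k.
    by rewrite Fm mulVf // subrr eqxx.
  by rewrite sub0r oppr_eq0 mulf_eq0 negb_or => /andP[_ fk]; apply: hFu => //; rewrite eq_sym.
(* Each variable [i] outside [B] divides a power of the variable [a] modulo [J] and the variables of
   [B], because [i |: B] is cofinite; these divisibilities are multiplied. *)
have key d : forall m', mdeg m' = d -> (forall i, i \in B -> m' i = 0%N) ->
    exists L s, modulo J B ('X_a ^+ L - 'X_[m'] * s).
  elim: d => [|d IH] m' dm hm'.
    exists 0%N, 1; rewrite expr0 mulr1; have /eqP-> : m' == 0%MM by rewrite -mdeg_eq0 dm.
    by rewrite mpolyX0 subrr; apply: (idl0 Rid).
  have [i mi] : exists i, m' i != 0%N.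
    apply/existsP; apply: contraT; rewrite negb_exists => /forallP h.
    move: dm; rewrite mdegE big1 // => i _; have := h i; by rewrite negbK => /eqP.
  have le : (U_(i) <= m')%MM by rewrite lep1mP.
  have iB : i \notin B by apply: contraNN mi => /hm' ->.
  have [||L [s Rs]] := IH (m' - U_(i))%MM.
  - by apply/eqP; rewrite -(eqn_add2r 1) [(d + 1)%N]addn1 -dm -(mdeg1 i) -mdegD submK.
  - by move=> j jB; rewrite mnmBE hm'.
  have [N finN] := fin i iB; have dN : mdeg (U_(a) *+ N)%MM = N by rewrite mdegMn mdeg1 mul1n.
  have [f1 [Jf1 /coord_ideal_split [t et]]] := finN _ dN.
  have Ri : modulo J B ('X_a ^+ N - 'X_i * t i).
    exists f1; split=> //; rewrite mpolyXn addrAC et big_setU1 //= addrAC subrr add0r.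
    apply: (idl_sum (coord_ideal_ideal K B)) => j _ jB.
    by apply: (idlMr (coord_ideal_ideal K B)); apply: coord_idealX.
  exists (N + L)%N, (t i * s); have := congr_mul Rid Ri Rs.
  by rewrite -exprD mulrACA -mpolyXD [(U_(i) + _)%MM]addmC submK.
have [mB [mA [em wmB hmA]]] := mnm_part B m.
have [L [s [f1 [Jf1 hf1]]]] := key _ mA erefl hmA.
have umA : wdeg u mA = 0%R.
  by apply: wdeg_eq0 => i mi; apply: unB; apply: contraNN mi => /hmA ->.
pose e0 := (mB + U_(a) *+ L)%MM.
have ue0 : wdeg u e0 = om.
  by rewrite /e0 /om em !wdegD umA wdegMn (wdeg_eq0 (w := u) (m := U_(a)%MM)) ?Rmult_0_r //
     => i; rewrite mnm1E; case: (a =P i) => // <- _; apply: unB.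
have He0 : ideal_sum2 J G 'X_[e0].
  (* The first summand is heavier than [om] since each variable of [B] adds positive weight, the
     second is a multiple of ['X_[m]], and the third lies in [J]. *)
  have -> : 'X_[e0] = 'X_[mB] * ('X_a ^+ L - 'X_[mA] * s - f1) + 'X_[m] * s + 'X_[mB] * f1.
    by rewrite /e0 mpolyXD -mpolyXn em mpolyXD !mulrBr mulrA addrAC subrK subrK.
  apply: (idlD Hid); last by apply: ideal_sum2l => //; apply: (idlM Jid).
  apply: (idlD Hid); last exact: (idlMr Hid).
  apply: ideal_sum2r => //.
  have hX : supp_in (fun k => k = mB) ('X_[mB] : P) by apply: supp_inX.
  apply: (supp_inM _ hX hf1) => x y -> [i iB yi].
  by have := wdeg_gt0 u0 yi (uB i iB); rewrite /om em !wdegD umA; lra.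
have [j [Jj Gj]] := He0; have [N finN] := fin a aB.
apply: (@no_relation J (a |: B) N u e0 ('X_[e0] - j)) => //.
- by move=> i; rewrite !inE negb_or => /andP[_ iB]; apply: unB.
- move=> i; rewrite !inE negb_or => /andP[ia iB].
  by rewrite mnmDE mulmnE mnm1E eq_sym (negPf ia) mul0n wmB.
- by rewrite opprB addrC subrK.
- by rewrite ue0.
Qed.

End NoMonomial.

(** * Generic fans *)

Lemma subset_of_card (T : finType) (S : {set T}) k : (k <= #|S|)%N ->
  exists2 C : {set T}, C \subset S & #|C| = k.
Proof.
move=> le; exists [set x in take k (enum S)].
  by apply/subsetP => x; rewrite inE => /mem_take; rewrite mem_enum.
rewrite cardsE (card_uniqP _) ?take_uniq ?enum_uniq //.
by rewrite size_take -cardE; case: ltngtP le.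
Qed.

Lemma superset_of_card (T : finType) (S : {set T}) k : (#|S| <= k <= #|T|)%N ->
  exists2 B : {set T}, S \subset B & #|B| = k.
Proof.
move=> /andP[le1 le2]; have [|C sub cC] := @subset_of_card T (~: S) (k - #|S|).
  by rewrite -(leq_add2l #|S|) subnKC // cardsC.
exists (S :|: C); first exact: subsetUl.
rewrite cardsU disjoint_setI0 ?cards0 ?subn0 ?cC ?subnKC //.
by rewrite disjoint_sym disjoints_subset.
Qed.

(** Compare [r] with the number of coordinates above the minimum: either [r] of them are available,
    or all of them fit into a set [B] of size [r - 1], which is not everything as [r <= n]. *)
Lemma weight_dichotomy n (w : 'I_n -> R) (r : nat) : (0 < n)%N -> (r <= n)%N ->
  (exists (C : {set 'I_n}) i0, [/\ #|C| = r, i0 \notin C, forall j, (w i0 <= w j)%R &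
     forall c, c \in C -> (w i0 < w c)%R]) \/
  (exists (B : {set 'I_n}) a mu, [/\ #|B|.+1 = r, a \notin B,
     forall i, i \notin B -> w i = mu & forall i, (mu <= w i)%R]).
Proof.
move=> n0 rn.
have [|i0 _ hi0] := ex_min_seq w (s := enum 'I_n).
  by rewrite -size_eq0 size_enum_ord -lt0n.
have wmin j : (w i0 <= w j)%R by apply: hi0; rewrite mem_enum.
pose S := [set c | ~~ Rleb (w c) (w i0)].
have memS c : c \in S -> (w i0 < w c)%R.
  by rewrite inE => /RlebP; lra.
have [le|lt] := leqP r #|S|.
  left; have [C /subsetP sub cC] := subset_of_card le; exists C, i0; split=> //.
    by apply/negP => /sub/memS; lra.
  by move=> c /sub/memS.
right; have r0 : (0 < r)%N by apply: leq_ltn_trans lt.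
have [|B /subsetP sub cB] := @superset_of_card _ S r.-1.
  by rewrite card_ord; apply/andP; split; lia.
have [a aB] : exists a, a \notin B.
  apply/existsP; apply: contraT; rewrite negb_exists => /forallP h.
  have e : B = setT by apply/setP => i; rewrite inE; have := h i; rewrite negbK.
  by move: cB; rewrite e cardsT card_ord; lia.
exists B, a, (w i0); split=> //; first by rewrite cB prednK.
move=> i iB; have := wmin i; have : i \notin S by apply: contraNN iB; apply: sub.
by rewrite inE negbK => /RlebP; lra.
Qed.

Section GenericFan.
Variables (K : closedFieldType) (n : nat).
Notation P := {mpoly K[n]}.
Implicit Types (I J : P -> Prop) (g h : 'M[K]_n).

(** The initial ideals are generated in degree at most [D], so it is enough to compare them on the
    part below [D.+1], where generic matrices share all bases. *)
Lemma generic_gcone I : is_graded_ideal I -> exists phi, nonvanishing phi /\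
  forall g h, g \in unitmx -> h \in unitmx -> phi g != 0 -> phi h != 0 ->
  forall w, gcone (ideal_act g I) w = gcone (ideal_act h I) w.
Proof.
move=> Igr; have [D gen] := uniform_init_generation Igr.
have [phi [nv hphi]] := @generic_bases K n I D.+1 (proj1 Igr).
exists phi; split; first exact: nv.
have half g h : g \in unitmx -> h \in unitmx -> phi g != 0 -> phi h != 0 -> forall w w',
    gcone (ideal_act g I) w w' -> forall p,
    init_ideal w (ideal_act h I) p -> init_ideal w' (ideal_act h I) p.
  move=> ug uh pg ph w w' e; apply: (@generated_incl _ _ _ _ D).
  - exact: init_ideal_ideal.
  - exact: init_ideal_ideal.
  - exact: gen.
  - apply: (init_eq_transfer (ideal_act_graded ug Igr) (ideal_act_graded uh Igr) _ e).
    by move=> B; split; apply: hphi.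
have half2 g h : g \in unitmx -> h \in unitmx -> phi g != 0 -> phi h != 0 -> forall w w',
    gcone (ideal_act g I) w w' -> gcone (ideal_act h I) w w'.
  move=> ug uh pg ph w w' e p; split; first exact: (half g h ug uh pg ph w w' e).
  by apply: (half g h ug uh pg ph w' w) => q; split; [apply: (proj2 (e q))|apply: (proj1 (e q))].
move=> g h ug uh pg ph w; apply: functional_extensionality => w'.
by apply: propositional_extensionality; split; apply: half2.
Qed.

(** In the first case of [weight_dichotomy] every generic initial ideal contains a monomial, in the
    second none does; the case depends on [w] alone. *)
Lemma generic_monomial_free I : is_graded_ideal I -> ~ I 1 -> (0 < n)%N ->
  exists phi, nonvanishing phi /\
  forall g h, g \in unitmx -> h \in unitmx -> phi g != 0 -> phi h != 0 ->
  forall w, (forall p, init_ideal w (ideal_act g I) p -> ~ is_monomial p) ->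
    forall p, init_ideal w (ideal_act h I) p -> ~ is_monomial p.
Proof.
move=> Igr I1 n0; have [r [phi [rn nv hphi]]] := generic_noether Igr I1.
exists phi; split; first exact: nv.
move=> g h ug uh pg ph w hg.
have [[C [i0 [cC i0C wmin wC]]]|[B [a [mu [cB aB wB wmin]]]]] := weight_dichotomy w n0 rn.
  have [[N fin] _] := hphi g ug pg C cC.
  have [p [Ip mp]] := cofinite_init_monomial (ideal_act_graded ug Igr) fin i0C wmin wC.
  by case: (hg p).
have cU i : i \notin B -> #|i |: B| = r by move=> iB; rewrite cardsU1 iB add1n.
apply: (no_init_monomial (ideal_act_graded uh Igr) aB _ _ wB wmin).
  by move=> i iB; have [] := hphi h uh ph _ (cU i iB).
by have [] := hphi h uh ph _ (cU a aB).
Qed.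

End GenericFan.

Theorem theorem6p8 (K : closedFieldType) (n : nat)
  (charK0 : GRing.pchar K =i pred0)
  (I : {mpoly K[n]} -> Prop)
  (Igr : is_graded_ideal I) (Ipr : is_prime_ideal I)
  (Idim : krull_dim_pos I) :
  exists U : 'M[K]_n -> Prop,
    [/\ zariski_open_GL U, (exists g, U g) &
        forall g h, U g -> U h ->
          trop_fan (ideal_act g I) = trop_fan (ideal_act h I)].
Proof.
have I1 : ~ I 1 by case: Ipr.
have [phi [nv hphi]] : exists phi, nonvanishing phi /\
    forall g h, g \in unitmx -> h \in unitmx -> phi g != 0 -> phi h != 0 ->
    forall w, (forall p, init_ideal w (ideal_act g I) p -> ~ is_monomial p) ->
      (forall p, init_ideal w (ideal_act h I) p -> ~ is_monomial p) /\
      gcone (ideal_act g I) w = gcone (ideal_act h I) w.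
  (* [weight_dichotomy] needs a coordinate; for [n = 0] there is only one matrix. *)
  have [n0|n0] := posnP n.
    exists (fun=> 1); split=> [|g h _ _ _ _ w hg].
      by split; [apply: polyfun_cst|exists 0; apply: oner_neq0].
    have -> : h = g by apply/matrixP => i; have := ltn_ord i; rewrite {2}n0.
    by split.
  have [phi1 [nv1 h1]] := generic_gcone Igr.
  have [phi2 [nv2 h2]] := generic_monomial_free Igr I1 n0.
  exists (fun g => phi1 g * phi2 g); split; first exact: nonvanishingM.
  move=> g h ug uh; rewrite !mulf_eq0 !negb_or => /andP[p1 p2] /andP[q1 q2] w hg.
  by split; [apply: h2 hg|apply: h1].
have [q hq] := proj1 nv.
exists (fun g => g \in unitmx /\ phi g != 0); split.
- exists (eq q) => g; split=> [[u pg]|[u [_ [<- pg]]]].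
    by split=> //; exists q; rewrite -hq.
  by rewrite hq.
- have [_ [g]] := nonvanishingM (nonvanishing_det K n) nv.
  rewrite mulf_eq0 negb_or => /andP[dg pg]; exists g; split=> //.
  by rewrite unitmxE unitfE.
have half g h : g \in unitmx /\ phi g != 0 -> h \in unitmx /\ phi h != 0 ->
    forall C, trop_fan (ideal_act g I) C -> trop_fan (ideal_act h I) C.
  move=> [ug pg] [uh ph] C [w [hw ->]].
  have [hw' e] := hphi g h ug uh pg ph w hw; exists w; split; [exact: hw'|exact: e].
move=> g h Ug Uh; apply: functional_extensionality => C.
by apply: propositional_extensionality; split; apply: half.
Qed.
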